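(* Let $N\ge 1$ and $k\ge 1$ be integers, and let $$q_{N,\mathbf N}(z)=\exp\big(G_{N,\mathbf N}(z)/F_{\mathbf N}(z)\big),\qquad F_{\mathbf N}(z)=\sum_{m=0}^\infty \frac{(Nm)!^k}{m!^{kN}}z^m,\qquad G_{N,\mathbf N}(z)=\sum_{m=1}^\infty H_{Nm}\frac{(Nm)!^k}{m!^{kN}}z^m .$$ Let $\Xi_1=1$, $\Xi_7=1/140$, and for $N\notin\{1,7\}$ let $$\Xi_N:=\prod_{p\le N}p^{\min\{2+\xi(p,N),\,v_p(H_N)\}},$$ the product being over all primes $p\le N$, where $\xi(p,N)=1$ if $p$ is a Wolstenholme prime or $p$ divides $N$, and $\xi(p,N)=0$ otherwise. Then $$q_{N,\mathbf N}(z)^{\frac{1}{\Xi_N N!^k}}\in\mathbb Z[[z]].$$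
   Context: $H_n=\sum_{i=1}^n \frac1i$ is the $n$-th harmonic number ($H_0=0$). $v_p$ is the $p$-adic valuation on $\mathbb Q$ (so $v_p(H_N)$ may be negative, and $\Xi_N$ is a positive rational number). $\mathbf N=(N,\dots,N)$ is the vector with $k$ occurrences of $N$. A prime $p$ is a Wolstenholme prime if $v_p(H_{p-1})\ge 3$. For a power series $q(z)=\exp(g(z))$ with $g(z)\in z\mathbb Q[[z]]$ and a rational number $\alpha$, $q(z)^\alpha$ denotes $\exp(\alpha g(z))$. *)

(* Defs.v *)
From mathcomp Require Import all_boot all_order all_algebra.

Set Implicit Arguments.
Unset Strict Implicit.
Unset Printing Implicit Defensive.

Import Order.TTheory GRing.Theory Num.Theory.
Local Open Scope ring_scope.

(* A formal power series a_0 + a_1 z + a_2 z^2 + ... in Q[[z]] is represented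
   by its coefficient function; equality of series is pointwise equality =1. *)
Definition fps := nat -> rat.

Definition fps_one : fps := fun n => (n == 0%N)%:R.

Definition fps_scale (c : rat) (a : fps) : fps := fun n => c * a n.

Definition fps_mul (a b : fps) : fps :=
  fun n => \sum_(i < n.+1) a i * b (n - i)%N.

Definition fps_pow (a : fps) (j : nat) : fps := iter j (fps_mul a) fps_one.

(* The first n coefficients of 1 / a, from the recursion
   b_0 = 1 / a_0,  b_n = - (a_1 b_{n-1} + ... + a_n b_0) / a_0. *)
Fixpoint fps_inv_prefix (a : fps) (n : nat) : seq rat :=
  if n is m.+1 then
    let s := fps_inv_prefix a m in
    rcons s (((m == 0%N)%:R - \sum_(i < m) a i.+1 * s`_(m - i.+1)) / a 0%N)
  else [::].

Definition fps_inv (a : fps) : fps := fun n => (fps_inv_prefix a n.+1)`_n.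

Definition fps_div (a b : fps) : fps := fps_mul a (fps_inv b).

(* exp(g) = \sum_j g^j / j!, meaningful when g_0 = 0: then g^j has no term of
   degree n < j, so truncating the sum at j = n loses nothing. *)
Definition fps_exp (g : fps) : fps :=
  fun n => \sum_(j < n.+1) fps_pow g j n / j`!%:R.

(* r = q^alpha, i.e. q = exp(g) with g in z Q[[z]] and r = exp(alpha g).
   Such a g is unique (fps_exp_inj), hence so is r (is_fps_rpow_uniq). *)
Definition is_fps_rpow (q : fps) (alpha : rat) (r : fps) : Prop :=
  exists g : fps,
    [/\ g 0%N = 0, q =1 fps_exp g & r =1 fps_exp (fps_scale alpha g)].

Definition harm (n : nat) : rat := \sum_(1 <= i < n.+1) i%:R^-1.

(* The p-adic valuation of a nonzero rational; it is only used at harmonic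
   numbers H_n with n > 0 (the junk value at 0 is 0, not +oo). *)
Definition ratval (p : nat) (x : rat) : int :=
  (logn p `|numq x|%N)%:Z - (logn p `|denq x|%N)%:Z.

Definition wolstenholme_prime (p : nat) : bool :=
  prime p && (3 <= ratval p (harm p.-1)).

Definition xi (p N : nat) : nat := wolstenholme_prime p || (p %| N)%N.

Definition Xi (N : nat) : rat :=
  if N == 1%N then 1
  else if N == 7%N then 1 / 140
  else \prod_(p < N.+1 | prime p)
         (p%:R : rat) ^ Num.min (2 + (xi p N)%:Z) (ratval p (harm N)).

Definition F (N k : nat) : fps :=
  fun m => ((N * m)`! ^ k)%N%:R / (m`! ^ (k * N))%N%:R.

(* The constant term vanishes because H_0 = 0. *)
Definition G (N k : nat) : fps :=
  fun m => harm (N * m)%N * F N k m.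

Definition q (N k : nat) : fps := fps_exp (fps_div (G N k) (F N k)).

Lemma size_fps_inv_prefix a n : size (fps_inv_prefix a n) = n.
Proof. by elim: n => //= n IH; rewrite size_rcons IH. Qed.

Lemma nth_fps_inv_prefix a n i : (i < n)%N ->
  (fps_inv_prefix a n)`_i = fps_inv a i.
Proof.
elim: n => // n IH; rewrite ltnS leq_eqVlt => /predU1P[->//|lt_in].
by rewrite /= nth_rcons size_fps_inv_prefix lt_in IH.
Qed.

Lemma fps_mul_inv (a : fps) : a 0%N != 0 -> fps_mul a (fps_inv a) =1 fps_one.
Proof.
move=> a0 n; rewrite /fps_mul big_ord_recl subn0 {1}/fps_inv /=.
rewrite nth_rcons size_fps_inv_prefix ltnn eqxx mulrC divfK //.
set S1 := \sum_(i < n) _; set S2 := \sum_(i < n) _.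
suff -> : S1 = S2 by rewrite subrK.
apply: eq_bigr => i _; rewrite nth_fps_inv_prefix //.
by rewrite ltn_subrL /=; apply: leq_ltn_trans (ltn_ord i).
Qed.

Lemma F0 N k : F N k 0%N = 1.
Proof. by rewrite /F muln0 fact0 !exp1n divr1. Qed.

Lemma fps_pow_agree (a b : fps) n j m : (forall i, (i <= n)%N -> a i = b i) ->
  (m <= n)%N -> fps_pow a j m = fps_pow b j m.
Proof.
move=> ab; elim: j m => // j IH m le_mn; apply: eq_bigr => i _.
rewrite ab; last by rewrite (leq_trans _ le_mn) // -ltnS.
by congr (_ * _); apply: IH; rewrite (leq_trans (leq_subr _ _)).
Qed.

Lemma fps_pow_const (a : fps) j : a 0%N = 0 -> fps_pow a j.+1 0%N = 0.
Proof. by move=> a0; rewrite /= /fps_mul big_ord1 a0 mul0r. Qed.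

Lemma fps_pow1 a : fps_pow a 1 =1 a.
Proof.
move=> n; rewrite /= /fps_mul big_ord_recr /= subnn mulr1 big1 ?add0r // => i _.
by rewrite /fps_one subn_eq0 leqNgt ltn_ord mulr0.
Qed.

Lemma fps_exp_inj (g h : fps) : g 0%N = 0 -> h 0%N = 0 ->
  fps_exp g =1 fps_exp h -> g =1 h.
Proof.
move=> g0 h0 gh n; elim/ltn_ind: n => -[|n] IH; first by rewrite g0 h0.
have expS u : fps_exp u n.+1 = fps_one n.+1 + u n.+1
    + \sum_(j < n) fps_pow u j.+2 n.+1 / j.+2`!%:R.
  rewrite -(fps_pow1 u) /fps_exp 2!big_ord_recl addrA fact0 divr1.
  by congr (_ + _ + _); apply: divr1.
have {gh} := gh n.+1; rewrite !expS.
set S1 := \sum_(i < n) _; set S2 := \sum_(i < n) _.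
suff -> : S1 = S2 by move=> /addIr /addrI.
apply: eq_bigr => j _; congr (_ / _).
change (fps_mul g (fps_pow g j.+1) n.+1 = fps_mul h (fps_pow h j.+1) n.+1).
apply: eq_bigr => -[[|i] /= lt_in] _; first by rewrite g0 h0 !mul0r.
move: lt_in; rewrite ltnS leq_eqVlt => /predU1P[[->]|lt_in].
  rewrite subnn [X in _ * X = _](fps_pow_const j g0).
  by rewrite [X in _ = _ * X](fps_pow_const j h0) !mulr0.
rewrite IH //; congr (_ * _).
apply: (@fps_pow_agree _ _ n j.+1); last by rewrite subSS leq_subr.
by move=> m le_mn; apply: IH.
Qed.

Lemma is_fps_rpow_uniq u alpha r s :
  is_fps_rpow u alpha r -> is_fps_rpow u alpha s -> r =1 s.
Proof.
case=> g [g0 ug rg] [h [h0 uh sh]] n.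
have gh : g =1 h by apply: fps_exp_inj => // m; rewrite -ug uh.
rewrite rg sh; apply: eq_bigr => j _; congr (_ / _).
by apply: (@fps_pow_agree _ _ n) => // i _; rewrite /fps_scale gh.
Qed.

(* Main.v *)
Require Import Defs.
From HB Require Import structures.
From mathcomp Require Import all_boot all_order all_algebra.
From mathcomp Require Import ring zify.
Import Order.TTheory GRing.Theory Num.Theory.
Local Open Scope ring_scope.

Set Implicit Arguments.
Unset Strict Implicit.
Unset Printing Implicit Defensive.

(* Put theta = 1 / Xi_N and write F for the coefficients of F_N(z).  Integrality is
   checked prime by prime.  By a criterion of Dieudonne-Dwork type it suffices
   that theta / N!^k times the coefficient of z^(a + K p) in
   F(z) G(z^p) - p F(z^p) G(z), that is
     theta / N!^k \sum_j F(a + j p) F(K - j) (H_(N(K - j)) - p H_(N(a + j p))),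
   lies in p Z_(p).  Up to the error terms p H_(N(a + j p)) - H_(N j), this is
   - \sum_j H_(N j) T_j with T_j = F(a + j p) F(K - j) - F(j) F(a + (K - j) p).
   Telescoping H_(N j) along the base p digits of j turns the sum into blocks of
   length p^s of the T_j, which are divisible by p^(s+1) F(m) by Dwork's
   congruences.  What is left is to bound F(m) (H_(N m) - H_(N p [m / p])) and
   p H_(N p j) - H_(N j) from below p-adically: the first bound uses that N is at
   least (t + 1) p when p <= N and p^t, t > 0, divides H_N (up to the cap in Xi_N), the
   second one Wolstenholme's theorem in the form
   \sum_(i <= n p, p not dividing i) 1 / i = n^2 H_(p-1) mod p^3. *)

(** * The local ring Z_(p) and the powers of its maximal ideal *)

(* zloc p is the local ring Z_(p), and zideal p e its ideal p^e Z_(p). *)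
Definition zloc (p : nat) : {pred rat} := fun x => coprime p `|denq x|%N.

Lemma zlocP p x :
  reflect (exists a : int, exists2 d : nat, (0 < d)%N && coprime p d &
             x = a%:~R / d%:R) (x \in zloc p).
Proof.
apply: (iffP idP) => [co_p | [a [d /andP[d_gt0 co_pd] ->]]].
  exists (numq x); exists `|denq x|%N; first by rewrite absz_gt0 denq_neq0.
  by rewrite -{1}(divq_num_den x) pmulrn absz_denq.
rewrite unfold_in; apply: coprime_dvdr co_pd; rewrite pmulrn.
have d0 : d%:Z != 0 by rewrite -lt0n.
rewrite -[X in (_ %| X)%N]/`|d%:Z|%N.
case: divqP d0 => [|k x' k0 _] //.
by rewrite abszM dvdn_mull.
Qed.

Lemma zloc_subring_closed p : subring_closed (zloc p).
Proof.
split=> [|x y /zlocP[a [d /andP[d0 cd] ->]] /zlocP[b [e /andP[e0 ce] ->]]|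
         x y /zlocP[a [d /andP[d0 cd] ->]] /zlocP[b [e /andP[e0 ce] ->]]].
- by rewrite unfold_in coprimen1.
- apply/zlocP; exists (a * e%:Z - b * d%:Z); exists (d * e)%N.
    by rewrite muln_gt0 d0 e0 coprimeMr cd ce.
  have ? : d%:R != 0 :> rat by rewrite pnatr_eq0 -lt0n.
  have ? : e%:R != 0 :> rat by rewrite pnatr_eq0 -lt0n.
  rewrite rmorphB !rmorphM /= -?pmulrn ?natrM; field; exact/andP.
- apply/zlocP; exists (a * b); exists (d * e)%N.
    by rewrite muln_gt0 d0 e0 coprimeMr cd ce.
  by rewrite rmorphM /= ?natrM mulf_div.
Qed.

HB.instance Definition _ p :=
  GRing.isSubringClosed.Build rat (zloc p) (zloc_subring_closed p).

Lemma zloc_div p (a : int) (d : nat) :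
  (0 < d)%N -> coprime p d -> a%:~R / d%:R \in zloc p.
Proof. by move=> d0 cd; apply/zlocP; exists a; exists d; rewrite ?d0. Qed.

Lemma zlocV p (d : nat) : (0 < d)%N -> coprime p d -> d%:R^-1 \in zloc p.
Proof. by move=> d0 cd; rewrite -[_^-1]mul1r -[1]/1%:~R zloc_div. Qed.

(** A denominator greater than 1 would have a least prime factor, and [x] is not in the local ring
    at that prime. *)
Lemma zloc_all_int (x : rat) :
  (forall p, prime p -> x \in zloc p) -> x \is a Num.int.
Proof.
move=> x_loc; rewrite -[x]divq_num_den.
suff -> : denq x = 1 by rewrite divr1 intr_int.
have := denq_gt0 x; case def_d: (denq x) => [d|//] d_gt0.
case: (ltngtP d 1) d_gt0 => [|d_gt1 _|->] //; first by case: (d).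
have := x_loc _ (pdiv_prime d_gt1); rewrite unfold_in def_d.
by rewrite prime_coprime ?pdiv_prime // pdiv_dvd.
Qed.

Definition zideal (p e : nat) : {pred rat} := fun x => x / p%:R ^+ e \in zloc p.

Lemma in_zideal p e x : (x \in zideal p e) = (x / p%:R ^+ e \in zloc p).
Proof. by []. Qed.

Lemma zideal_zmod_closed p e : zmod_closed (zideal p e).
Proof.
split=> [|x y]; rewrite !in_zideal ?mul0r ?rpred0 // mulrBl.
exact: rpredB.
Qed.

HB.instance Definition _ p e :=
  GRing.isZmodClosed.Build rat (zideal p e) (zideal_zmod_closed p e).

Lemma zideal0 p x : (x \in zideal p 0) = (x \in zloc p).
Proof. by rewrite in_zideal expr0 divr1. Qed.

Lemma zidealM p e f x y :
  x \in zideal p e -> y \in zideal p f -> x * y \in zideal p (e + f).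
Proof. by rewrite !in_zideal exprD -mulf_div => *; apply: rpredM. Qed.

Lemma zidealMl p e x y : x \in zloc p -> y \in zideal p e -> x * y \in zideal p e.
Proof. by rewrite -zideal0; apply: zidealM. Qed.

Lemma zidealMr p e x y : x \in zideal p e -> y \in zloc p -> x * y \in zideal p e.
Proof. by rewrite mulrC => *; apply: zidealMl. Qed.

Lemma zideal_expn p e : prime p -> p%:R ^+ e \in zideal p e.
Proof.
move=> p_pr; rewrite in_zideal divff ?rpred1 //.
by rewrite expf_neq0 // pnatr_eq0 -lt0n prime_gt0.
Qed.

Lemma zideal_p p : prime p -> p%:R \in zideal p 1.
Proof. exact: (@zideal_expn p 1). Qed.

Lemma zidealE p e x : prime p ->
  reflect (exists2 y, y \in zloc p & x = p%:R ^+ e * y) (x \in zideal p e).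
Proof.
move=> p_pr; have p0 : p%:R ^+ e != 0 :> rat.
  by rewrite expf_neq0 // pnatr_eq0 -lt0n prime_gt0.
apply: (iffP idP) => [x_e | [y y_p ->]].
  by exists (x / p%:R ^+ e); rewrite // mulrC divfK.
by rewrite in_zideal mulrC mulKf.
Qed.

Lemma zidealW p e f x : prime p -> (f <= e)%N -> x \in zideal p e -> x \in zideal p f.
Proof.
move=> p_pr le_fe /(zidealE _ _ p_pr)[y y_p ->]; apply/(zidealE _ _ p_pr).
exists (p%:R ^+ (e - f) * y); last by rewrite mulrA -exprD subnKC.
by rewrite rpredM ?rpredX ?rpred_nat.
Qed.

Lemma zideal_loc p e x : prime p -> x \in zideal p e -> x \in zloc p.
Proof. by move=> p_pr; rewrite -zideal0; apply: zidealW. Qed.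

Lemma zideal_nat p e (n : nat) : prime p -> (p ^ e %| n)%N -> n%:R \in zideal p e.
Proof.
move=> p_pr /dvdnP[m ->]; apply/(zidealE _ _ p_pr); exists m%:R.
  exact: rpred_nat.
by rewrite natrM natrX mulrC.
Qed.

Lemma zideal_natP p e (n : nat) : prime p -> n%:R \in zideal p e -> (p ^ e %| n)%N.
Proof.
move=> p_pr; rewrite in_zideal => /zlocP[a [d /andP[d0 cd]] def_n].
have pe0 : (p ^ e)%:R != 0 :> rat by rewrite pnatr_eq0 -lt0n expn_gt0 prime_gt0.
have dn0 : d%:R != 0 :> rat by rewrite pnatr_eq0 -lt0n.
suff dv : (p ^ e %| n * d)%N.
  by move: dv; rewrite Gauss_dvdl // coprimeXl.
have /eqP := def_n; rewrite -natrX eqr_div // -natrM.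
rewrite pmulrn [(p ^ e)%:R]pmulrn -rmorphM /= eqr_int => /eqP /(congr1 absz) /=.
by rewrite abszM /= => ->; rewrite dvdn_mull.
Qed.

Lemma zideal_cancel p e f x : prime p ->
  p%:R ^+ f * x \in zideal p (e + f) -> x \in zideal p e.
Proof.
move=> p_pr /(zidealE _ _ p_pr)[y y_p def_x]; apply/(zidealE _ _ p_pr).
exists y => //; have p0 : p%:R ^+ f != 0 :> rat.
  by rewrite expf_neq0 // pnatr_eq0 -lt0n prime_gt0.
by apply: (mulfI p0); rewrite def_x exprD mulrCA mulrA.
Qed.

Lemma zideal_unitl p e (d : nat) x : (0 < d)%N -> coprime p d ->
  d%:R * x \in zideal p e -> x \in zideal p e.
Proof.
move=> d0 cd /(zidealMl (zlocV d0 cd)).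
by rewrite mulKf // pnatr_eq0 -lt0n.
Qed.

(** * Integrality of exponentials of power series *)

(** Coefficients up to degree [n] only depend on truncations, so commutativity, associativity and
    the Leibniz rule for series are inherited from [{poly rat}]. *)
Definition fps_trunc n (a : fps) : {poly rat} := \poly_(i < n.+1) a i.

Lemma coef_fps_trunc n a m : (m <= n)%N -> (fps_trunc n a)`_m = a m.
Proof. by move=> le_mn; rewrite coef_poly ltnS le_mn. Qed.

Lemma eq_coefM (R : nzRingType) (p p' q q' : {poly R}) n :
  (forall m, (m <= n)%N -> p`_m = p'`_m) -> (forall m, (m <= n)%N -> q`_m = q'`_m) ->
  forall m, (m <= n)%N -> (p * q)`_m = (p' * q')`_m.
Proof.
move=> pp' qq' m le_mn; rewrite !coefM; apply: eq_bigr => i _.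
have le_im : (i <= m)%N by rewrite -ltnS.
by rewrite pp' ?qq' // (leq_trans _ le_mn) ?leq_subr.
Qed.

Lemma coefM_fps_trunc n a b m : (m <= n)%N ->
  (fps_trunc n a * fps_trunc n b)`_m = fps_mul a b m.
Proof.
move=> le_mn; rewrite coefM; apply: eq_bigr => i _.
have le_im : (i <= m)%N by rewrite -ltnS.
by rewrite !coef_fps_trunc // (leq_trans _ le_mn) ?leq_subr.
Qed.

Lemma eq_fps_mul a a' b b' n :
  (forall m, (m <= n)%N -> a m = a' m) -> (forall m, (m <= n)%N -> b m = b' m) ->
  fps_mul a b n = fps_mul a' b' n.
Proof.
move=> aa' bb'; apply: eq_bigr => i _.
have le_in : (i <= n)%N by rewrite -ltnS.
by rewrite aa' // bb' // leq_subr.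
Qed.

Lemma fps_mulC a b : fps_mul a b =1 fps_mul b a.
Proof. by move=> n; rewrite -!(coefM_fps_trunc _ _ (leqnn n)) mulrC. Qed.

Lemma fps_mulA a b c : fps_mul a (fps_mul b c) =1 fps_mul (fps_mul a b) c.
Proof.
move=> n; have tr u m : (m <= n)%N -> (fps_trunc n u)`_m = u m.
  exact: coef_fps_trunc.
have trM u v m : (m <= n)%N ->
    (fps_trunc n (fps_mul u v))`_m = (fps_trunc n u * fps_trunc n v)`_m.
  by move=> le_mn; rewrite tr // coefM_fps_trunc.
rewrite -2!(coefM_fps_trunc _ _ (leqnn n)).
rewrite (eq_coefM (fun _ _ => erefl) (trM b c)) //.
by rewrite (eq_coefM (trM a b) (fun _ _ => erefl)) // mulrA.
Qed.

Lemma fps_mul_oner a : fps_mul a fps_one =1 a.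
Proof.
move=> n; rewrite /fps_mul big_ord_recr /= subnn mulr1 big1 ?add0r // => i _.
by rewrite /fps_one subn_eq0 leqNgt ltn_ord mulr0.
Qed.

Lemma fps_powE a j n m : (m <= n)%N -> fps_pow a j m = (fps_trunc n a ^+ j)`_m.
Proof.
elim: j m => [|j IH] m le_mn; first by rewrite coef1.
rewrite exprS coefM /=; apply: eq_bigr => i _.
have le_im : (i <= m)%N by rewrite -ltnS.
by rewrite coef_fps_trunc ?IH // (leq_trans _ le_mn) ?leq_subr.
Qed.

(** The coefficientwise form of E' = a E: for E(0) = 1, [a] is the logarithmic derivative of [E]. *)
Definition log_derive (a E : fps) :=
  forall n, n.+1%:R * E n.+1 = fps_mul a E n.

Lemma fps_pow_val (h : fps) j n : h 0%N = 0 -> (n < j)%N -> fps_pow h j n = 0.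
Proof.
move=> h0; elim: j n => // j IH n lt_nj; apply: big1 => -[[|i] /= lt_in] _.
  by rewrite h0 mul0r.
change (h i.+1 * fps_pow h j (n - i.+1)%N = 0); rewrite IH ?mulr0 //; lia.
Qed.

Lemma fps_exp_widen (h : fps) n m : h 0%N = 0 -> (n <= m)%N ->
  fps_exp h n = \sum_(j < m.+1) fps_pow h j n / j`!%:R.
Proof.
move=> h0 le_nm; rewrite /fps_exp (big_ord_widen_cond m.+1 xpredT
  (fun j => fps_pow h j n / j`!%:R)) // big_mkcond; apply: eq_bigr => j _ /=.
by case: ltnP => // lt_nj; rewrite fps_pow_val ?mul0r.
Qed.

(** exp(h)' = h' exp(h), obtained termwise from (h^(j+1))' = (j+1) h' h^j; the term j = 0 of the
    exponential has no coefficient in positive degree. *)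
Lemma fps_exp_log_derive (h : fps) : h 0%N = 0 ->
  log_derive (fun i => i.+1%:R * h i.+1) (fps_exp h).
Proof.
move=> h0 n; rewrite {1}/fps_exp big_ord_recl [fps_pow h _ _](_ : _ = 0) // mul0r add0r mulr_sumr.
transitivity (\sum_(j < n.+1) fps_mul (fun i => i.+1%:R * h i.+1) (fps_pow h j) n
                / j`!%:R).
  apply: eq_bigr => j _; rewrite lift0 (fps_powE _ _ (leqnn _)).
  rewrite factS natrM; set P := fps_trunc n.+1 h.
  have -> : n.+1%:R * ((P ^+ j.+1)`_n.+1 / (j.+1%:R * (j`!)%:R)) =
      (P ^+ j.+1)^`()`_n / (j.+1%:R * (j`!)%:R).
    by rewrite coef_deriv -[_`_n.+1 *+ _]mulr_natl mulrA.
  rewrite deriv_exp /= coefMn -[X in X / _]mulr_natl -mulf_div divff ?pnatr_eq0 // mul1r.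
  congr (_ / _); rewrite coefM; apply: eq_bigr => i _.
  have le_in : (i <= n)%N by rewrite -ltnS.
  rewrite (fps_powE _ _ (leq_trans (leq_subr i n) (leqnSn n))).
  by rewrite coef_deriv coef_fps_trunc // mulr_natl.
under eq_bigr do rewrite mulr_suml.
rewrite exchange_big; apply: eq_bigr => i _ /=.
rewrite (fps_exp_widen h0 (leq_subr i n)) mulr_sumr.
by apply: eq_bigr => j _; rewrite mulrA.
Qed.

(** E' = a E is a recursion that computes each coefficient of [E] from the earlier ones. *)
Lemma log_derive_uniq a b E F n : log_derive a E -> log_derive b F ->
  (forall i, (i < n)%N -> a i = b i) -> E 0%N = F 0%N ->
  forall m, (m <= n)%N -> E m = F m.
Proof.
move=> aE bF ab EF0; elim/ltn_ind => -[//|m] IH lt_mn.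
have m0 : m.+1%:R != 0 :> rat by rewrite pnatr_eq0.
apply: (mulfI m0); rewrite aE bF; apply: eq_fps_mul => i le_im.
  by rewrite ab // (leq_ltn_trans le_im).
by apply: IH; rewrite // (leq_trans le_im) // ltnW.
Qed.

Lemma log_deriveM a b E F : log_derive a E -> log_derive b F ->
  log_derive (fun i => a i + b i) (fps_mul E F).
Proof.
move=> aE bF n.
have deE u U : log_derive u U -> forall m, (m <= n)%N ->
    (fps_trunc n.+1 U)^`()`_m = (fps_trunc n.+1 u * fps_trunc n.+1 U)`_m.
  move=> uU m le_mn; rewrite coef_deriv coef_fps_trunc // -mulr_natl uU.
  by rewrite coefM_fps_trunc // ltnW.
rewrite -(coefM_fps_trunc _ _ (leqnn n.+1)) mulr_natl -coef_deriv derivM coefD.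
rewrite (eq_coefM (deE _ _ aE) (fun _ _ => erefl) (leqnn n)).
rewrite (eq_coefM (fun _ _ => erefl) (deE _ _ bF) (leqnn n)).
have trE m : (m <= n)%N ->
    (fps_trunc n.+1 E * fps_trunc n.+1 F)`_m = (fps_trunc n (fps_mul E F))`_m.
  by move=> le_mn; rewrite coefM_fps_trunc ?coef_fps_trunc // ltnW.
have trD m : (m <= n)%N -> (fps_trunc n.+1 a + fps_trunc n.+1 b)`_m
    = (fps_trunc n (fun i => a i + b i))`_m.
  by move=> le_mn; rewrite coefD !coef_fps_trunc // ltnW.
rewrite -coefD mulrCA -mulrA -mulrDl.
by rewrite (eq_coefM trD trE (leqnn n)) coefM_fps_trunc.
Qed.

Definition zfps (E : fps) := E 0%N = 1 /\ forall n, E n \is a Num.int.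

Lemma zfpsM E F : zfps E -> zfps F -> zfps (fps_mul E F).
Proof.
move=> [E0 Ez] [F0 Fz]; split; first by rewrite /fps_mul big_ord1 E0 F0 mulr1.
by move=> n; apply: rpred_sum => i _; apply: rpredM.
Qed.

(** Coefficients of d z^(d-1) / (1 - z^d), the logarithmic derivative of 1 / (1 - z^d). *)
Definition lambert (d i : nat) : rat := (if (d %| i.+1)%N then d else 0%N)%:R.

Lemma lambert_recl d m : (0 < d)%N ->
  lambert d m = d%:R * (m == d.-1)%:R + (if (d <= m)%N then lambert d (m - d) else 0).
Proof.
move=> d_gt0; rewrite /lambert; case: leqP => [le_dm | lt_md].
  rewrite -[in LHS](subnKC (leqW le_dm)) dvdn_addr // subSn //.
  by rewrite (_ : m == _ = false) ?mulr0 ?add0r //; lia.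
rewrite addr0; case: eqP => [->|neq]; first by rewrite prednK // dvdnn mulr1.
rewrite mulr0; case: ifP => // /dvdn_leq; lia.
Qed.

Lemma log_derive_1sub d : (0 < d)%N ->
  log_derive (fun i => - lambert d i) (fun n => (n == 0%N)%:R - (n == d)%:R).
Proof.
move=> d_gt0 n.
have trE m : (m <= n)%N -> (fps_trunc n (fun n => (n == 0%N)%:R - (n == d)%:R))`_m
    = (1 - 'X^d : {poly rat})`_m.
  by move=> le_mn; rewrite coef_fps_trunc // coefB coef1 coefXn.
rewrite -(coefM_fps_trunc _ _ (leqnn n)).
rewrite (eq_coefM (fun _ _ => erefl) trE (leqnn n)) [in RHS]mulrBr mulr1 coefB coefMXn.
rewrite coef_fps_trunc // sub0r lambert_recl //.
have -> : (n.+1 == d) = (n == d.-1) by lia.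
rewrite mulrN; case: ltnP => [lt_nd|le_dn].
  by rewrite addr0 subr0; case: eqP => [->|_]; rewrite ?mulr0 // prednK.
by rewrite coef_fps_trunc ?leq_subr // (_ : n == _ = false); [rewrite !mulr0; ring | lia].
Qed.

Lemma log_derive_geom d : (0 < d)%N ->
  log_derive (lambert d) (fun n => (d %| n)%:R).
Proof.
move=> d_gt0 n.
have sum_lambert m : \sum_(i < m) lambert d i = (d * (m %/ d))%:R.
  elim: m => [|m IH]; first by rewrite big_ord0 div0n muln0.
  rewrite big_ord_recr /= IH /lambert -natrD divnS //.
  by case: (d %| m.+1)%N; congr (_%:R); lia.
have [dv|ndv] := boolP (d %| n.+1)%N.
  rewrite mulr1 -[in LHS](divnK dv) mulnC -sum_lambert; apply: eq_bigr => i _.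
  rewrite /lambert; case: ifP => [dv_i|_]; last by rewrite mul0r.
  have le_in : (i < n.+1)%N by [].
  by rewrite -(dvdn_addr _ dv_i) addSn subnKC // dv mulr1.
rewrite mulr0 /fps_mul big1 // => i _; rewrite /lambert.
case: ifP => [dv_i|_]; last by rewrite mul0r.
case dv_n: (d %| n - i)%N; last by rewrite mulr0.
have le_in : (i < n.+1)%N by [].
by case/negP: ndv; rewrite -(subnKC le_in) dvdn_add // subSS.
Qed.

Lemma zfps_1sub d : (0 < d)%N -> zfps (fun n => (n == 0%N)%:R - (n == d)%:R).
Proof.
move=> d_gt0; split; first by rewrite eqxx eq_sym gtn_eqF // subr0.
by move=> n; rewrite rpredB ?rpred_nat.
Qed.

Lemma zfps_geom d : zfps (fun n => (d %| n)%:R).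
Proof. by split=> [|n]; rewrite ?dvdn0 ?rpred_nat. Qed.

(** The series is (1 - z^d)^(-c): a power of the geometric series for c >= 0, of the polynomial 1 -
    z^d for c < 0. Both have integral coefficients. *)
Lemma zfps_pow_lambert d (c : int) : (0 < d)%N ->
  exists2 E, zfps E & log_derive (fun i => c%:~R * lambert d i) E.
Proof.
have z1 : zfps fps_one by split=> // n; rewrite rpred_nat.
have ldP a E : log_derive a E -> zfps E -> forall m : nat,
    exists2 F, zfps F & log_derive (fun i => m%:R * a i) F.
  move=> aE zE; elim=> [|m [F zF aF]].
    by exists fps_one => // n; rewrite mulr0 /fps_mul big1 // => i; rewrite !mul0r.
  exists (fps_mul E F); first exact: zfpsM.
  move=> n; rewrite (log_deriveM aE aF); apply: eq_fps_mul => // i _.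
  by rewrite -natr1 mulrDl mul1r addrC.
move=> d_gt0; case: c => m.
  exact: ldP (log_derive_geom d_gt0) (zfps_geom d) m.
have [F zF aF] := ldP _ _ (log_derive_1sub d_gt0) (zfps_1sub d_gt0) m.+1.
exists F => // n; rewrite aF; apply: eq_fps_mul => // i _.
by rewrite NegzE rmorphN /= -pmulrn mulNr mulrN.
Qed.

Lemma zfps_prod_lambert (c : nat -> int) n :
  exists2 E, zfps E &
    log_derive (fun i => \sum_(1 <= d < n.+1) (c d)%:~R * lambert d i) E.
Proof.
elim: n => [|n [F zF aF]].
  exists fps_one; first by split=> // n; rewrite rpred_nat.
  by move=> n; rewrite mulr0 /fps_mul big1 // => i; rewrite big_nil mul0r.
have [E zE aE] := zfps_pow_lambert (c n.+1) (ltn0Sn n).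
exists (fps_mul F E); first exact: zfpsM.
move=> m; rewrite (log_deriveM aF aE); apply: eq_fps_mul => // i _.
by rewrite [in RHS]big_nat_recr.
Qed.

(* A power series h with exp(h) = \prod_d (1 - z^d)^(- c_d) satisfies
   i h_i = \sum_(d | i) d c_d; the congruences make the c_d integral. *)
Lemma fps_exp_int (h : fps) : h 0%N = 0 ->
  (forall p i, prime p -> (0 < i)%N ->
     h i - (if (p %| i)%N then h (i %/ p)%N / p%:R else 0) \in zloc p) ->
  forall n, fps_exp h n \is a Num.int.
Proof.
move=> h0 h_loc n.
have [c def_c] : exists c : nat -> int, forall i, (0 < i <= n)%N ->
    i%:R * h i = \sum_(1 <= d < n.+1 | (d %| i)%N) (c d)%:~R * d%:R.
  elim: n => [|n [c IH]]; first by exists (fun=> 0) => i; lia.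
  (* The value that c_(n+1) is forced to take by the divisor sum for i = n+1. *)
  pose x := h n.+1 - (\sum_(1 <= d < n.+1 | (d %| n.+1)%N) (c d)%:~R * d%:R) / n.+1%:R.
  have /intrP[y def_y] : x \is a Num.int.
    apply: zloc_all_int => p p_pr.
    have p0 : p%:R != 0 :> rat by rewrite pnatr_eq0 -lt0n prime_gt0.
    have n0 : n.+1%:R != 0 :> rat by rewrite pnatr_eq0.
    have loc_d d : (d %| n.+1)%N -> ~~ (p %| n.+1 %/ d)%N ->
        (c d)%:~R * d%:R / n.+1%:R \in zloc p.
      move=> dv ndv; have d_gt0 : (0 < d)%N by apply: dvdn_gt0 dv.
      have d0 : d%:R != 0 :> rat by rewrite pnatr_eq0 -lt0n.
      rewrite -mulrA rpredM ?rpred_int //.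
      rewrite -[X in _ / X%:R](divnK dv) natrM invfM mulrCA divff // mulr1.
      apply: zlocV; last by rewrite prime_coprime.
      by rewrite divn_gt0 // dvdn_leq.
    have := h_loc p n.+1 p_pr isT; case: ifP => [dv_p|ndv_p] loc_h; last first.
      rewrite subr0 in loc_h; rewrite /x rpredB // mulr_suml rpred_sum // => d dv_d.
      apply: loc_d => //; apply: contraFN ndv_p => dv_pd.
      by rewrite -(divnK dv_d) dvdn_mulr.
    (* By the induction hypothesis, h_((n+1)/p) / p accounts for exactly those d that divide
       (n+1)/p; for the other divisors d, [p] does not divide (n+1)/d and [loc_d] applies. *)
    rewrite /x -[h _](subrK (h (n.+1 %/ p)%N / p%:R)) -addrA rpredD //.
    have le_np : (0 < n.+1 %/ p <= n)%N.
      by rewrite divn_gt0 ?prime_gt0 // dvdn_leq // -ltnS ltn_Pdiv ?prime_gt1.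
    have -> : h (n.+1 %/ p)%N / p%:R = (n.+1 %/ p)%:R * h (n.+1 %/ p)%N / n.+1%:R.
      rewrite -[in RHS](divnK dv_p); set m := (n.+1 %/ p)%N in le_np *.
      rewrite mulnK ?prime_gt0 // natrM.
      have m0 : m%:R != 0 :> rat by rewrite pnatr_eq0 -lt0n; case/andP: le_np.
      by field; rewrite p0 m0.
    rewrite IH // -mulrBl big_mkcond [X in _ - X]big_mkcond -sumrB mulr_suml.
    apply: rpred_sum => d _.
    case: ifP => [dv_d|ndv_d].
      by rewrite (dvdn_trans dv_d) ?subrr ?mul0r ?rpred0 // dvdn_div // dvdn_mulr.
    case: ifP => [dv_d|_]; last by rewrite subrr mul0r rpred0.
    rewrite sub0r mulNr rpredN loc_d //; apply: contraFN ndv_d => dv_pd.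
    by rewrite -(divnK dv_d) -(divnK dv_pd) -mulnA mulnCA mulKn ?prime_gt0 // dvdn_mull.
  exists (fun d => if d == n.+1 then y else c d) => i /andP[i_gt0 le_in].
  rewrite big_mkcond big_nat_recr //= eqxx.
  under eq_big_nat => d /andP[_ lt_dn] do rewrite ltn_eqF //.
  rewrite -big_mkcond; case: (ltngtP i n.+1) le_in => // [lt_in|->] _.
    by rewrite gtnNdvd // addr0 IH // i_gt0.
  rewrite dvdnn -def_y /x mulrBl divfK ?pnatr_eq0 // mulrC addrC subrK.
  by [].
have [E [E0 Ez] aE] := zfps_prod_lambert c n.
rewrite (log_derive_uniq (n := n) (fps_exp_log_derive h0) aE) // => [i lt_in|].
  rewrite def_c // big_mkcond; apply: eq_bigr => d _.
  by rewrite /lambert; case: ifP; rewrite ?mulr0.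
by rewrite E0 /fps_exp big_ord1 /fps_pow /= /fps_one divr1.
Qed.

(** * The substitution of z^p for z *)

Lemma divn_small_addM p a K : (a < p)%N -> ((a + K * p) %/ p)%N = K.
Proof.
by move=> lt_ap; rewrite divnDMl ?divn_small // (leq_ltn_trans _ lt_ap).
Qed.

Definition fps_expand (p : nat) (u : fps) : fps :=
  fun n => if (p %| n)%N then u (n %/ p)%N else 0.

Lemma sum_multiples (p n : nat) (f : nat -> rat) : (0 < p)%N ->
  \sum_(0 <= i < n.+1 | (p %| i)%N) f i
    = \sum_(0 <= j < (n %/ p).+1) f (j * p)%N.
Proof.
move=> p_gt0; elim: n => [|n IH].
  by rewrite div0n big_mkcond !big_nat1 dvdn0.
rewrite big_mkcond big_nat_recr //= -big_mkcond IH divnS //.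
case: ifP => [dv|_]; last by rewrite addr0 add0n.
rewrite add1n [in RHS]big_nat_recr //=; congr (_ + f _).
by rewrite -[LHS](divnK dv) divnS // dv.
Qed.

Lemma fps_mul_expand p u v a K : (a < p)%N ->
  fps_mul u (fps_expand p v) (a + K * p)%N
    = \sum_(0 <= j < K.+1) u (a + j * p)%N * v (K - j)%N.
Proof.
move=> lt_ap; have p_gt0 : (0 < p)%N by apply: leq_ltn_trans lt_ap.
rewrite fps_mulC /fps_mul -(big_mkord xpredT
  (fun i => fps_expand p v i * u (a + K * p - i)%N)).
transitivity (\sum_(0 <= i < (a + K * p).+1 | (p %| i)%N)
    v (i %/ p)%N * u (a + K * p - i)%N).
  rewrite [RHS]big_mkcond; apply: eq_bigr => i _; rewrite /fps_expand.
  by case: ifP; rewrite ?mul0r.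
rewrite (sum_multiples _ (fun i => v (i %/ p)%N * u (a + K * p - i)%N)) //.
rewrite divn_small_addM // big_nat_rev /= add0n.
apply: eq_big_nat => j /andP[_ lt_jK]; rewrite subSS mulnK // mulrC.
by congr (u _ * _); rewrite -addnBA ?leq_mul2r ?leq_subr ?orbT // -mulnBl subKn.
Qed.

Lemma fps_expandM p u v : (0 < p)%N ->
  fps_expand p (fps_mul u v) =1 fps_mul (fps_expand p u) (fps_expand p v).
Proof.
move=> p_gt0 n; rewrite (divn_eq n p) addnC fps_mul_expand ?ltn_mod //.
rewrite /fps_expand dvdn_addl ?dvdn_mull // divn_small_addM ?ltn_mod //.
case: ifP => dv.
  rewrite /fps_mul -(big_mkord xpredT (fun i => u i * v (n %/ p - i)%N)).
  apply: eq_bigr => j _; rewrite dvdn_addl ?dvdn_mull // dv.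
  by rewrite divn_small_addM ?ltn_mod.
by rewrite big1 // => j _; rewrite dvdn_addl ?dvdn_mull // dv mul0r.
Qed.

(* F(z) F(z^p) (g(z^p) - p g(z)) = F(z) G(z^p) - p F(z^p) G(z) when F g = G. *)
Lemma dwork_quotient p (F G g : fps) theta : prime p -> F 0%N = 1 ->
  (forall n, F n \in zloc p) -> fps_mul F g =1 G ->
  (forall n, theta * (fps_mul F (fps_expand p G) n
                       - p%:R * fps_mul G (fps_expand p F) n) \in zideal p 1) ->
  forall n, theta * (fps_expand p g n - p%:R * g n) \in zideal p 1.
Proof.
move=> p_pr F0 F_loc Fg C_loc; have p_gt0 := prime_gt0 p_pr.
pose w : fps := fun n => theta * (fps_expand p g n - p%:R * g n).
pose FF := fps_mul F (fps_expand p F).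
have FFw n : fps_mul FF w n = theta * (fps_mul F (fps_expand p G) n
                       - p%:R * fps_mul G (fps_expand p F) n).
  have -> : fps_mul F (fps_expand p G) n = fps_mul FF (fps_expand p g) n.
    rewrite -fps_mulA; apply: eq_fps_mul => // m _; rewrite -fps_expandM //.
    by rewrite /fps_expand Fg.
  have -> : fps_mul G (fps_expand p F) n = fps_mul FF g n.
    transitivity (fps_mul (fps_mul (fps_expand p F) F) g n).
      by rewrite -fps_mulA fps_mulC; apply: eq_fps_mul => // m _; rewrite Fg.
    by apply: eq_fps_mul => // m _; rewrite fps_mulC.
  rewrite /fps_mul mulr_sumr -sumrB mulr_sumr; apply: eq_bigr => i _.
  rewrite /w; ring.
have FF0 : FF 0%N = 1.
  by rewrite /FF /fps_mul big_ord1 /fps_expand dvdn0 div0n F0 mulr1.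
have FF_loc n : FF n \in zloc p.
  apply: rpred_sum => i _; rewrite rpredM // /fps_expand.
  by case: ifP; rewrite ?rpred0.
(* Since [FF] has constant term 1 and p-integral coefficients, w_n is the coefficient of [FF] w at
   [n] minus terms covered by induction. *)
elim/ltn_ind => n IH; change (w n \in zideal p 1).
have := C_loc n; rewrite -FFw {1}/fps_mul big_ord_recl FF0 mul1r subn0.
rewrite rpredDr // rpred_sum // => i _; apply: zidealMl => //.
by apply: IH; rewrite lift0; have := ltn_ord i; lia.
Qed.

(** * Dwork's congruences *)

Lemma sum_blocks (n q : nat) (f : nat -> rat) :
  \sum_(j < n * q) f j = \sum_(u < n) \sum_(i < q) f (i + u * q)%N.
Proof.
elim: n => [|n IH]; first by rewrite mul0n !big_ord0.
rewrite mulSnr big_split_ord big_ord_recr -IH /=; congr (_ + _).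
by apply: eq_bigr => i _; rewrite addnC.
Qed.

Section DworkCongruence.

(** [W v m] is the quotient A(v + m p) / A(m), for a digit v < p. Dwork's hypotheses are that it is
    p-integral and that a change of [m] by a multiple of p^s changes it by a multiple of p^(s+1). *)
Variables (p : nat) (A : nat -> rat) (W : nat -> nat -> rat).
Hypotheses (p_pr : prime p) (A0 : A 0%N = 1) (A_neq0 : forall n, A n != 0)
  (A_loc : forall n, A n \in zloc p)
  (AW : forall v m, (v < p)%N -> A (v + m * p)%N = A m * W v m)
  (W_loc : forall v m, (v < p)%N -> W v m \in zloc p)
  (W_cong : forall v u n s, (v < p)%N ->
     W v (u + n * p ^ s)%N - W v u \in zideal p s.+1).

Let ratio s m j : rat := A (j + m * p ^ s)%N / A j.

(** Induction on [s] strips the last base p digit of [u]; by [AW] each digit contributes a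
    p-integral factor [W]. *)
Lemma dwork_loc s u n : (u < p ^ s)%N -> A (u + n * p ^ s)%N / A n \in zloc p.
Proof.
have p_gt0 := prime_gt0 p_pr.
elim: s u => [|s IH] u lt_u.
  by move: lt_u; rewrite expn0 ltnS leqn0 => /eqP->; rewrite muln1 divff ?rpred1.
rewrite (divn_eq u p) expnSr mulnA addnAC -mulnDl addnC AW ?ltn_mod //.
by rewrite mulrAC rpredM ?W_loc ?ltn_mod // IH // ltn_divLR // -expnSr.
Qed.

(** Passing from [u] to v + u p multiplies the two values of [A] in the ratio by two values of [W]
    at congruent arguments, so only the difference of these two survives. *)
Lemma dwork_ratio s v u n : (v < p)%N -> (u < p ^ s)%N ->
  A (v + u * p)%N * (ratio s.+1 n (v + u * p) - ratio s n u) / A n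
    \in zideal p s.+1.
Proof.
move=> lt_vp lt_u; rewrite /ratio expnSr mulnA -addnA -mulnDl !AW //.
have W0 : W v u != 0 by have := A_neq0 (v + u * p); rewrite AW // mulf_eq0 => /norP[].
have -> : A u * W v u * (A (u + n * p ^ s)%N * W v (u + n * p ^ s)%N / (A u * W v u)
    - A (u + n * p ^ s)%N / A u) / A n =
    A (u + n * p ^ s)%N / A n * (W v (u + n * p ^ s)%N - W v u).
  by field; rewrite !A_neq0 W0.
by apply: zidealMl; [apply: dwork_loc | apply: W_cong].
Qed.

Variables (a : nat) (lt_ap : (a < p)%N).

(** The value 0 beyond [K] replaces the meaningless truncated subtraction and lets the sums run over
    full blocks of length p^s. *)
Definition dwork_term K j : rat :=
  if (j <= K)%N then A (a + j * p)%N * A (K - j)%N - A j * A (a + (K - j) * p)%N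
  else 0.

Definition dwork_sum K s m : rat := \sum_(i < p ^ s) dwork_term K (i + m * p ^ s)%N.

Lemma dwork_sumS K s m :
  dwork_sum K s.+1 m = \sum_(i < p) dwork_sum K s (i + m * p)%N.
Proof.
rewrite /dwork_sum expnS (sum_blocks p (p ^ s)
  (fun i => dwork_term K (i + m * (p * p ^ s))%N)).
by apply: eq_bigr => v _; apply: eq_bigr => i _; rewrite mulnDl mulnA addnA.
Qed.

(** The terms are antisymmetric under j -> K - j, and the blocks cover all j <= K. *)
Lemma dwork_sum_eq0 K s n : (K < n * p ^ s)%N -> \sum_(m < n) dwork_sum K s m = 0.
Proof.
move=> lt_K; rewrite -(sum_blocks n (p ^ s) (dwork_term K)).
rewrite -(big_mkord xpredT) (big_cat_nat (n := K.+1)) //=.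
have -> : \sum_(K.+1 <= j < n * p ^ s) dwork_term K j = 0.
  rewrite big_nat big1 // => j /andP[lt_j _].
  by rewrite /dwork_term leqNgt lt_j.
rewrite addr0.
have -> : \sum_(0 <= j < K.+1) dwork_term K j = \sum_(0 <= j < K.+1)
    (A (a + j * p)%N * A (K - j)%N - A j * A (a + (K - j) * p)%N).
  by apply: eq_big_nat => j /andP[_ lt_j]; rewrite /dwork_term -ltnS lt_j.
rewrite sumrB [X in _ - X]big_nat_rev /= add0n; apply/eqP.
rewrite subr_eq0; apply/eqP; apply: eq_big_nat => j /andP[_ lt_j].
by rewrite subSS subKn // mulrC.
Qed.

Lemma dwork_sum_far K s m : (K < m * p ^ s)%N -> dwork_sum K s m = 0.
Proof.
move=> lt_K; apply: big1 => i _; rewrite /dwork_term leqNgt.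
by rewrite (leq_trans lt_K) ?leq_addl.
Qed.

(* Dwork's induction: [beta 0 s] holds, [alpha t] turns [beta t s] into
   [beta t.+1 s], and [beta s s] reduces [alpha s] to [m = 0], where the vanishing
   of the sum of all blocks concludes. *)
Let beta t s := forall K m,
  (dwork_sum (K + m * p ^ s) s m
    - \sum_(j < p ^ (s - t)) ratio (s - t) m j * dwork_sum K t j) / A m
    \in zideal p s.+1.

Let alpha s := forall K m, dwork_sum K s m / A m \in zideal p s.+1.

Lemma dwork_beta0 s : beta 0 s.
Proof.
move=> K m; rewrite subn0 /dwork_sum -sumrB mulr_suml rpred_sum // => j _.
rewrite expn0 big_ord1 add0n muln1 /dwork_term leq_add2r subnDr.
case: leqP => [le_jK|_]; last by rewrite mulr0 subrr mul0r rpred0.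
have -> : A (j + m * p ^ s)%N = ratio s m j * A j.
  by rewrite /ratio divfK.
have -> : A (a + (j + m * p ^ s) * p)%N = ratio s.+1 m (a + j * p)%N * A (a + j * p)%N.
  by rewrite /ratio divfK // expnSr mulnA mulnDl addnA.
have -> : (ratio s.+1 m (a + j * p) * A (a + j * p)%N * A (K - j)%N -
     ratio s m j * A j * A (a + (K - j) * p)%N -
     ratio s m j * (A (a + j * p)%N * A (K - j)%N - A j * A (a + (K - j) * p)%N)) / A m
   = A (K - j)%N * (A (a + j * p)%N * (ratio s.+1 m (a + j * p) - ratio s m j) / A m).
  by ring.
by apply: zidealMl => //; apply: dwork_ratio.
Qed.

(** Each block of level t+1 is cut into [p] blocks of level [t]. Replacing their ratios by a common
    one costs an error divisible by p^(s-t) by [dwork_ratio], times a block sum divisible by p^(t+1)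
    by [alpha t]. *)
Lemma dwork_betaS t s : (t < s)%N -> alpha t -> beta t s -> beta t.+1 s.
Proof.
move=> lt_ts al be K m.
suff dif : (\sum_(j < p ^ (s - t)) ratio (s - t) m j * dwork_sum K t j -
     \sum_(j < p ^ (s - t.+1)) ratio (s - t.+1) m j * dwork_sum K t.+1 j) / A m
    \in zideal p s.+1.
  by have := rpredD (be K m) dif; rewrite -mulrDl addrA subrK.
set r := (s - t.+1)%N; have -> : (s - t = r.+1)%N by rewrite /r; lia.
rewrite expnSr (sum_blocks _ _ (fun j => ratio r.+1 m j * dwork_sum K t j)).
rewrite -sumrB mulr_suml rpred_sum // => u _.
rewrite dwork_sumS mulr_sumr -sumrB mulr_suml rpred_sum // => i _.
set j := (i + u * p)%N.
have -> : (ratio r.+1 m j * dwork_sum K t j - ratio r m u * dwork_sum K t j) / A m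
   = A j * (ratio r.+1 m j - ratio r m u) / A m * (dwork_sum K t j / A j).
  by field; rewrite !A_neq0.
have -> : s.+1 = (r.+1 + t.+1)%N by rewrite /r; lia.
by apply: zidealM; [apply: dwork_ratio | apply: al].
Qed.

Lemma dwork_congruence K s m : dwork_sum K s m / A m \in zideal p s.+1.
Proof.
suff : alpha s by apply.
elim/ltn_ind: s {K m} => s al.
have be : beta s s.
  suff : forall t, (t <= s)%N -> beta t s by apply.
  elim=> [|t IH] le_ts; first exact: dwork_beta0.
  by apply: dwork_betaS => //; [apply: al | apply/IH/ltnW].
have p_gt0 := prime_gt0 p_pr; have ps_gt0 : (0 < p ^ s)%N by rewrite expn_gt0 p_gt0.
(* For t = s the sum in [beta] has the single term j = 0, with ratio A(m) / A(0) = A(m). *)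
have {}be K m : dwork_sum (K + m * p ^ s) s m / A m - dwork_sum K s 0
    \in zideal p s.+1.
  have := be K m; rewrite subnn expn0 big_ord1 /ratio add0n expn0 muln1 A0 divr1.
  by rewrite mulrBl mulrAC divff // mul1r.
(* Strong induction on [K]: each block m > 0 is, modulo the ideal, A(m) times the block 0 for the
   smaller index K - m p^s, and all blocks add up to 0. *)
have s0 K : dwork_sum K s 0 \in zideal p s.+1.
  elim/ltn_ind: K => K IH.
  have /eqP := @dwork_sum_eq0 K s K.+1 (leq_pmulr _ ps_gt0).
  rewrite big_ord_recl addr_eq0 => /eqP->; rewrite rpredN rpred_sum // => m _.
  rewrite lift0; case: (leqP (m.+1 * p ^ s) K) => [le_K|/dwork_sum_far->]; last first.
    exact: rpred0.
  have := be (K - m.+1 * p ^ s)%N m.+1; rewrite subnK // => be_m.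
  have lt_K : (K - m.+1 * p ^ s < K)%N.
    by rewrite ltn_subrL (leq_trans _ le_K) ?muln_gt0 ?ps_gt0.
  have := zidealMr (rpredD be_m (IH _ lt_K)) (A_loc m.+1).
  by rewrite subrK divfK.
move=> K m; case: (leqP (m * p ^ s) K) => [le_K|/dwork_sum_far->]; last first.
  by rewrite mul0r rpred0.
have := rpredD (be (K - m * p ^ s)%N m) (s0 (K - m * p ^ s)%N).
by rewrite subrK subnK.
Qed.

End DworkCongruence.

(** * Factorial ratios and harmonic numbers *)

(** Up to sign, the value of Morita's p-adic Gamma function at n+1. *)
Definition fact_coprime (p n : nat) : nat := \prod_(1 <= i < n.+1 | ~~ (p %| i)%N) i.

Definition harm_coprime (p n : nat) : rat :=
  \sum_(1 <= i < n.+1 | ~~ (p %| i)%N) i%:R^-1.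

Definition rising (A x : nat) : nat := \prod_(1 <= i < x.+1) (A + i).

Lemma fact_coprimeS p n : fact_coprime p n.+1 =
  (fact_coprime p n * (if (p %| n.+1)%N then 1 else n.+1))%N.
Proof.
rewrite /fact_coprime big_mkcond big_nat_recr //= -big_mkcond.
by case: (p %| n.+1)%N.
Qed.

Lemma fact_coprime_split p n : (0 < p)%N ->
  n`! = (p ^ (n %/ p) * (n %/ p)`! * fact_coprime p n)%N.
Proof.
move=> p_gt0; elim: n => [|n IH]; first by rewrite div0n /fact_coprime big_nil.
rewrite fact_coprimeS factS IH divnS //; case: ifP => [dv|_]; last first.
  by rewrite add0n mulnCA; congr muln; rewrite mulnC.
rewrite add1n expnS factS muln1 -[n.+1](divnK dv) divnS // dv add1n; ring.
Qed.

Lemma coprime_fact_coprime p n : prime p -> coprime p (fact_coprime p n).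
Proof.
move=> p_pr; elim: n => [|n IH]; first by rewrite /fact_coprime big_nil coprimen1.
rewrite fact_coprimeS coprimeMr IH; case: ifP => [_|/negbT]; first exact: coprimen1.
by rewrite prime_coprime.
Qed.

Lemma fact_coprime_gt0 p n : (0 < fact_coprime p n)%N.
Proof. by rewrite /fact_coprime big_nat_cond prodn_cond_gt0 // => -[]. Qed.

(** A shift by a multiple [q] of [p] changes neither the residue of a factor modulo [q] nor whether
    it is divisible by [p]. *)
Lemma fact_coprimeD p q x : (p %| q)%N ->
  fact_coprime p (q + x) = fact_coprime p q * fact_coprime p x %[mod q].
Proof.
move=> dv_q; elim: x => [|x IH].
  by rewrite addn0 {3}/fact_coprime big_nil muln1.
rewrite addnS !fact_coprimeS -addnS dvdn_addr //.
rewrite mulnA -modnMml IH modnMml; case: ifP => _ //.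
by rewrite -modnMmr modnDl modnMmr.
Qed.

Lemma fact_coprimeDM p q x n : (p %| q)%N ->
  fact_coprime p (x + n * q) = fact_coprime p q ^ n * fact_coprime p x %[mod q].
Proof.
move=> dv_q; elim: n => [|n IH]; first by rewrite addn0 expn0 mul1n.
rewrite mulSn addnCA fact_coprimeD // expnS -modnMmr IH modnMmr.
by rewrite mulnA.
Qed.

Lemma risingS A x : rising A x.+1 = (rising A x * (A + x.+1))%N.
Proof. by rewrite /rising big_nat_recr. Qed.

Lemma risingD A x y : rising A (x + y) = (rising A x * rising (A + x) y)%N.
Proof.
elim: y => [|y IH]; first by rewrite addn0 {3}/rising big_nil muln1.
by rewrite addnS !risingS IH -mulnA -addnS addnA.
Qed.

Lemma fact_rising A x : (A + x)`! = (A`! * rising A x)%N.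
Proof.
elim: x => [|x IH]; first by rewrite addn0 /rising big_nil muln1.
by rewrite addnS factS IH risingS -addnS mulnC mulnA.
Qed.

Lemma rising_mod A q n x : rising (A + n * q) x = rising A x %[mod q].
Proof.
elim: x => [|x IH]; first by rewrite /rising !big_nil.
by rewrite !risingS -modnMm IH [(A + _)%N]addnC -addnA modnMDl modnMm.
Qed.

Lemma coprime_rising p m a : prime p -> (a < p)%N -> coprime p (rising (m * p) a).
Proof.
move=> p_pr; elim: a => [|a IH] lt_ap; first by rewrite /rising big_nil coprimen1.
rewrite risingS coprimeMr IH ?(ltnW lt_ap) // prime_coprime //.
by rewrite dvdn_addr ?dvdn_mull // gtnNdvd.
Qed.

(** A product of [x] consecutive integers is divisible by x!, hence by p^[x/p]. *)
Lemma dvdn_exp_rising p A x : (0 < p)%N -> (p ^ (x %/ p) %| rising A x)%N.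
Proof.
move=> p_gt0; apply: (@dvdn_trans x`!).
  by rewrite (fact_coprime_split x p_gt0) -mulnA dvdn_mulr.
apply/dvdnP; exists 'C(A + x, x); have /eqP := bin_fact (leq_addl A x).
by rewrite addnK fact_rising mulnA [X in _ == X]mulnC eqn_pmul2r ?fact_gt0 // => /eqP.
Qed.

Lemma harmD A x : harm (A + x)%N - harm A = \sum_(1 <= i < x.+1) (A + i)%N%:R^-1.
Proof.
elim: x => [|x IH]; first by rewrite addn0 subrr big_nil.
by rewrite addnS big_nat_recr //= -IH {1}/harm big_nat_recr //= addrAC addnS.
Qed.

(* Removing one factor from a run of x >= (t+1) p consecutive integers leaves
   at least t multiples of p. *)
Lemma rising_harm p t A x : prime p -> (t == 0%N) || (t.+1 * p <= x)%N ->
  (rising A x)%:R * (harm (A + x)%N - harm A) \in zideal p t.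
Proof.
move=> p_pr cond; have p_gt0 := prime_gt0 p_pr.
rewrite harmD mulr_sumr big_nat_cond; apply: rpred_sum => i /andP[/andP[i_gt0 le_ix] _].
have -> : rising A x = (rising A i.-1 * (A + i) * rising (A + i) (x - i))%N.
  rewrite -{1}(subnKC (_ : i <= x)%N) // risingD; congr muln.
  by rewrite -[in LHS](prednK i_gt0) risingS prednK.
have Ai0 : (A + i)%N%:R != 0 :> rat by rewrite pnatr_eq0; lia.
rewrite mulnAC natrM mulfK //; apply: zideal_nat => //.
case: eqP cond => [-> _|_ /= le_x]; first exact: dvd1n.
have le_t : (t <= i.-1 %/ p + (x - i) %/ p)%N.
  have e1 := divn_eq i.-1 p; have e2 := divn_eq (x - i) p.
  have l1 := ltn_pmod i.-1 p_gt0; have l2 := ltn_pmod (x - i) p_gt0.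
  rewrite -ltnS -(ltn_pmul2r p_gt0) mulSn mulnDl.
  move: le_x; rewrite mulSn; lia.
apply: dvdn_trans (dvdn_exp2l p le_t) _.
by rewrite expnD dvdn_mul ?dvdn_exp_rising.
Qed.

Lemma harm_split p n : prime p -> harm n = harm (n %/ p) / p%:R + harm_coprime p n.
Proof.
move=> p_pr; have p_gt0 := prime_gt0 p_pr.
elim: n => [|n IH]; first by rewrite div0n /harm /harm_coprime !big_nil mul0r addr0.
rewrite /harm_coprime big_mkcond big_nat_recr //= -big_mkcond.
rewrite {1}/harm big_nat_recr //= -[X in X + _]/(harm n) IH divnS //.
have [dv|_] /= := boolP (p %| n.+1)%N; last by rewrite add0n addrA.
rewrite add1n {2}/harm big_nat_recr //= -/(harm _) mulrDl addr0 addrAC.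
by rewrite -[X in _ + X%:R^-1](divnK dv) natrM invfM divnS // dv add1n.
Qed.

Definition fact_ratio (N m : nat) : rat := (N * m)`!%:R / (m`! ^ N)%:R.

Lemma F_fact_ratio N k m : F N k m = fact_ratio N m ^+ k.
Proof. by rewrite /F /fact_ratio expr_div_n !natrX -exprM [(N * k)%N]mulnC. Qed.

Lemma natr_fact_neq0 n : n`!%:R != 0 :> rat.
Proof. by rewrite pnatr_eq0 -lt0n fact_gt0. Qed.

Lemma natr_expfact_neq0 n N : (n`! ^ N)%:R != 0 :> rat.
Proof. by rewrite natrX expf_neq0 ?natr_fact_neq0. Qed.

Lemma fact_ratio_neq0 N m : fact_ratio N m != 0.
Proof. by rewrite mulf_neq0 ?invr_eq0 ?natr_fact_neq0 ?natr_expfact_neq0. Qed.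

Lemma F_neq0 N k m : F N k m != 0.
Proof. by rewrite F_fact_ratio expf_neq0 ?fact_ratio_neq0. Qed.

Lemma fact_ratio1 N : fact_ratio N 1 = N`!%:R.
Proof. by rewrite /fact_ratio muln1 exp1n divr1. Qed.

(** The quotient counts the partitions of N m points into [N] blocks of size [m]. The induction
    rests on C((N+1)m, m) = (N+1) C((N+1)m - 1, m - 1), which needs m > 0. *)
Lemma dvdn_fact_mul N m : (0 < m)%N -> (N`! * m`! ^ N %| (N * m)`!)%N.
Proof.
case: m => // m _; elim: N => [|N IH]; first by rewrite mul0n.
have le_m : (m.+1 <= N.+1 * m.+1)%N by rewrite leq_pmull.
have := bin_fact le_m; rewrite mulSn addKn => <-.
have -> : 'C(m.+1 + N * m.+1, m.+1) = (N.+1 * 'C(m + N * m.+1, m))%N.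
  apply/eqP; rewrite -(eqn_pmul2l (ltn0Sn m)) addSn -mul_bin_diag /= mulnA.
  by rewrite [(m.+1 * _)%N]mulnC mulSn.
rewrite factS expnS.
have -> : (N.+1 * N`! * (m.+1`! * m.+1`! ^ N) =
  N.+1 * (m.+1`! * (N`! * m.+1`! ^ N)))%N by ring.
by rewrite -[X in (_ %| X)%N]mulnA dvdn_pmul2l // dvdn_mull // dvdn_pmul2l ?fact_gt0.
Qed.

Lemma fact_ratio_div1_nat N m : (0 < m)%N ->
  exists n : nat, fact_ratio N m / fact_ratio N 1 = n%:R.
Proof.
move=> m_gt0; have /dvdnP[n def_n] := dvdn_fact_mul N m_gt0.
exists n; rewrite fact_ratio1 /fact_ratio def_n !natrM natrX.
by field; rewrite ?expf_neq0 ?natr_fact_neq0.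
Qed.

(** As F(1) = N!^k, this is what absorbs the factor N!^k in the exponent of the theorem. *)
Lemma F_div1_loc p N k m : (0 < m)%N -> F N k m / F N k 1 \in zloc p.
Proof.
move=> m_gt0; rewrite !F_fact_ratio -expr_div_n rpredX //.
by have [n ->] := fact_ratio_div1_nat N m_gt0; apply: rpred_nat.
Qed.

Lemma F_loc p N k m : F N k m \in zloc p.
Proof.
case: m => [|m]; first by rewrite F0 rpred1.
rewrite -[F _ _ _](divfK (F_neq0 N k 1)) rpredM ?F_div1_loc //.
by rewrite F_fact_ratio fact_ratio1 rpredX ?rpred_nat.
Qed.

(** The quotient W of Dwork's congruences for k = 1. The powers of [p] contributed by (N m p)! and
    (v + m p)!^N cancel, so the denominator is prime to [p]. *)
Definition fact_ratio_step p N v m : rat :=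
  (fact_coprime p (N * (m * p)) * rising (N * (m * p)) (N * v))%:R
    / (fact_coprime p (v + m * p) ^ N)%:R.

Lemma fact_ratio_stepE p N v m : prime p -> (v < p)%N ->
  fact_ratio N (v + m * p) = fact_ratio N m * fact_ratio_step p N v m.
Proof.
move=> p_pr lt_vp; have p_gt0 := prime_gt0 p_pr.
rewrite /fact_ratio /fact_ratio_step mulnDr addnC fact_rising.
have div_p : (N * (m * p) %/ p = N * m)%N by rewrite mulnA mulnK.
rewrite (fact_coprime_split (N * _) p_gt0) div_p.
rewrite (fact_coprime_split (v + m * p) p_gt0) divn_small_addM //.
rewrite !expnMn -expnM [(m * N)%N]mulnC !natrM.
field; rewrite natr_expfact_neq0 !pnatr_eq0 -!lt0n !expn_gt0 p_gt0.
by rewrite fact_coprime_gt0.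
Qed.

Lemma fact_ratio_step_loc p N v m : prime p -> fact_ratio_step p N v m \in zloc p.
Proof.
move=> p_pr; rewrite rpredM ?rpred_nat // zlocV ?expn_gt0 ?fact_coprime_gt0 //.
by rewrite coprimeXr // coprime_fact_coprime.
Qed.

(* Passing from u to u + n p^s multiplies numerator and denominator by the same
   factor fact_coprime p (p^(s+1)) ^ (N n) modulo p^(s+1). *)
Lemma fact_ratio_step_cong p N v u n s : prime p ->
  fact_ratio_step p N v (u + n * p ^ s) - fact_ratio_step p N v u \in zideal p s.+1.
Proof.
move=> p_pr; rewrite /fact_ratio_step.
set d1 := fact_coprime p (v + _); set d2 := fact_coprime p (v + u * p).
set n1 := (_ * _)%N; set n2 := (fact_coprime p (N * (u * p)) * _)%N.
have dv : (p %| p ^ s.+1)%N by rewrite expnS dvdn_mulr.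
have co_d d : coprime p (fact_coprime p d ^ N) by rewrite coprimeXr ?coprime_fact_coprime.
have d_gt0 d : (0 < fact_coprime p d ^ N)%N by rewrite expn_gt0 fact_coprime_gt0.
set q := (p ^ s.+1)%N in dv *; set e := fact_coprime p q.
have n12 : n1 = e ^ (N * n) * n2 %[mod q].
  rewrite /n1 (_ : N * ((u + n * p ^ s) * p) = N * (u * p) + N * n * q)%N; last first.
    by rewrite /q expnS; ring.
  rewrite -modnMm fact_coprimeDM //.
  by rewrite rising_mod modnMm -mulnA.
have d12 : d1 ^ N = e ^ (N * n) * d2 ^ N %[mod q].
  rewrite /d1 (_ : v + (u + n * p ^ s) * p = v + u * p + n * q)%N; last first.
    by rewrite /q expnS; ring.
  rewrite -modnXm fact_coprimeDM // modnXm.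
  by rewrite expnMn -expnM [(n * N)%N]mulnC.
have e21 : n2 * d1 ^ N = n2 * (e ^ (N * n) * d2 ^ N) %[mod q].
  by rewrite -modnMmr d12 modnMmr.
have : (n1 * d2 ^ N == n2 * d1 ^ N %[mod q])%N.
  by apply/eqP; rewrite -modnMml n12 modnMml e21; congr (_ %% _)%N; ring.
have -> : n1%:R / (d1 ^ N)%:R - n2%:R / (d2 ^ N)%:R =
   ((n1 * d2 ^ N)%:R - (n2 * d1 ^ N)%:R) / (d1 ^ N * d2 ^ N)%:R :> rat.
  rewrite !natrM; field; rewrite !pnatr_eq0 -!lt0n !d_gt0 //.
set x := (n1 * _)%N; set y := (n2 * _)%N => eq_xy.
apply: zidealMr; last by rewrite zlocV ?muln_gt0 ?d_gt0 // coprimeMr !co_d.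
wlog le_yx : x y eq_xy / (y <= x)%N.
  move=> IH; case/orP: (leq_total y x) => [|le_xy]; first exact: IH.
  by rewrite -rpredN opprB IH // eq_sym.
by rewrite -natrB // zideal_nat // -eqn_mod_dvd // eq_sym eqn_mod_dvd // -eqn_mod_dvd.
Qed.

Lemma F_dwork_congruence p N k a K s m : prime p -> (a < p)%N ->
  dwork_sum p (F N k) a K s m / F N k m \in zideal p s.+1.
Proof.
move=> p_pr lt_ap.
apply: (@dwork_congruence p (F N k) (fun v m => fact_ratio_step p N v m ^+ k)) => //.
- exact: F0.
- exact: F_neq0.
- exact: F_loc.
- by move=> v j lt_vp; rewrite !F_fact_ratio fact_ratio_stepE // exprMn.
- by move=> v j _; rewrite rpredX ?fact_ratio_step_loc.
move=> v u n r _; rewrite subrXX zidealMr ?fact_ratio_step_cong //.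
by apply: rpred_sum => i _; rewrite rpredM ?rpredX ?fact_ratio_step_loc.
Qed.

(** * Local bounds for harmonic differences and the congruence between F and G *)

Lemma F_harm_loc p N k t theta m : prime p -> (0 < k)%N ->
  theta * harm N \in zloc p -> theta * p%:R ^+ t \in zloc p ->
  (t == 0%N) || (t.+1 * p <= N)%N -> (0 < m)%N ->
  theta * (F N k m / F N k 1) * (harm (N * m)%N - harm (N * (m %/ p * p))%N)
    \in zloc p.
Proof.
move=> p_pr k_gt0 th_harm th_t cond m_gt0.
have p_gt0 := prime_gt0 p_pr.
have th_ideal x : x \in zideal p t -> theta * x \in zloc p.
  by case/(zidealE _ _ p_pr) => y y_loc ->; rewrite mulrA rpredM.
have [n def_n] := fact_ratio_div1_nat N m_gt0.
(* One factor of the k-th power compensates the harmonic difference; the other k - 1 are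
   integers. *)
suff b_loc : theta * (fact_ratio N m / fact_ratio N 1 *
    (harm (N * m)%N - harm (N * (m %/ p * p))%N)) \in zloc p.
  rewrite !F_fact_ratio -expr_div_n -(prednK k_gt0) exprS.
  set b := fact_ratio N m / _ in def_n b_loc *; set d := harm _ - _ in b_loc *.
  have -> : theta * (b * b ^+ k.-1) * d = theta * (b * d) * b ^+ k.-1 by ring.
  by rewrite rpredM // def_n rpredX ?rpred_nat.
have f0 := natr_fact_neq0.
set a := (m %% p)%N; have lt_ap : (a < p)%N by rewrite ltn_mod.
have def_m : m = (a + m %/ p * p)%N by rewrite addnC -divn_eq.
(* For m >= p, put M = p [m/p] and m = M + a. The factors of (N m)! beyond (N M)! form a run of
   length N a >= N, to which [rising_harm] applies, and those of m! beyond M! are prime to [p]. *)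
have [m_eq0|m_gt0'] := posnP (m %/ p); last first.
  set M := (m %/ p * p)%N in def_m *.
  have [n' def_n'] : exists n : nat, fact_ratio N M / fact_ratio N 1 = n%:R.
    by apply: fact_ratio_div1_nat; rewrite muln_gt0 m_gt0'.
  have [a0|a_gt0] := posnP a; first by rewrite def_m a0 add0n subrr !mulr0 rpred0.
  have r0 : (rising M a)%:R != 0 :> rat.
    have := f0 (M + a)%N; rewrite fact_rising natrM mulf_eq0 => /norP[] //.
  have -> : fact_ratio N m / fact_ratio N 1 * (harm (N * m)%N - harm (N * M)%N) =
     n'%:R * (rising M a ^ N)%:R^-1 *
     ((rising (N * M) (N * a))%:R * (harm (N * M + N * a)%N - harm (N * M)%N)).
    have def_Nm : (N * m = N * M + N * a)%N by rewrite -mulnDr addnC -def_m.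
    rewrite -def_n' /fact_ratio def_Nm [in m`!]def_m [(a + M)%N]addnC !fact_rising expnMn.
    by rewrite !natrM; field; rewrite f0 !natrX !expf_neq0 // f0.
  rewrite mulrCA rpredM //.
    by rewrite rpredM ?rpred_nat // zlocV ?expn_gt0 ?coprimeXr ?coprime_rising //;
       rewrite -(ltr0n rat) lt0r r0 ler0n.
  apply: th_ideal; apply: rising_harm => //; case/orP: cond => [->//|le_N].
  by rewrite (leq_trans le_N) ?orbT // leq_pmulr.
have lt_mp : (m < p)%N by rewrite def_m m_eq0 mul0n addn0.
rewrite m_eq0 mul0n muln0 [harm 0]big_nil subr0.
have def_Nm : (N * m = N + N * m.-1)%N by rewrite -mulnS prednK.
(* For m < p, the part H_N is controlled by [theta] itself; the rest involves a run of length N (m -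
   1), which is empty for m = 1 and at least [N] long otherwise. *)
rewrite -[harm (N * m)%N](subrK (harm N)) mulrDr mulrDr rpredD //; last first.
  by rewrite mulrCA def_n rpredM ?rpred_nat.
have -> : fact_ratio N m / fact_ratio N 1 * (harm (N * m)%N - harm N) =
  (m`! ^ N)%:R^-1 * ((rising N (N * m.-1))%:R * (harm (N + N * m.-1)%N - harm N)).
  rewrite fact_ratio1 /fact_ratio def_Nm fact_rising natrM.
  by field; rewrite f0 natr_expfact_neq0.
rewrite mulrCA rpredM //.
  rewrite zlocV ?expn_gt0 ?fact_gt0 // coprimeXr // prime_coprime //.
  rewrite (fact_coprime_split m p_gt0) m_eq0 expn0 fact0 !mul1n -prime_coprime //.
  exact: coprime_fact_coprime.
case: (ltngtP m 1) m_gt0 => // [m_gt1|->] _; last first.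
  by rewrite muln0 addn0 subrr !mulr0 rpred0.
apply: th_ideal; apply: rising_harm => //; case/orP: cond => [->//|le_N].
by rewrite (leq_trans le_N) ?orbT // leq_pmulr // -subn1 subn_gt0.
Qed.

(** The two local conditions on theta = 1 / Xi_N from which the congruence between F and G follows.
    The first compares H at N m and at N p [m/p], the second is of Wolstenholme type. *)
Definition harm_ok p N k theta :=
  (forall m, (0 < m)%N -> theta * (F N k m / F N k 1) *
      (harm (N * m)%N - harm (N * (m %/ p * p))%N) \in zloc p)
  /\ (forall j, theta * harm_coprime p (N * (j * p)) \in zloc p).

(** By [harm_split], multiplying the arguments by [p] divides the harmonic difference by [p] and
    adds sums over integers prime to [p], which the second condition of [harm_ok] controls. *)
Lemma harm_level_loc p N k theta m s : prime p -> harm_ok p N k theta -> (0 < m)%N ->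
  theta * (F N k m / F N k 1) * p%:R ^+ s *
    (harm (N * (m * p ^ s))%N - harm (N * (m %/ p * p * p ^ s))%N) \in zloc p.
Proof.
move=> p_pr [F_ok c_ok] m_gt0; have p_gt0 := prime_gt0 p_pr.
have p0 : p%:R != 0 :> rat by rewrite pnatr_eq0 -lt0n.
elim: s => [|s IH]; first by rewrite expn0 expr0 !muln1 mulr1 F_ok.
have split j : harm (N * (j * p ^ s.+1))%N =
    harm (N * (j * p ^ s))%N / p%:R + harm_coprime p (N * (j * p ^ s * p)).
  by rewrite (harm_split _ p_pr) expnSr !mulnA mulnK.
rewrite !split opprD addrACA -mulrBl.
set x := _ - _ in IH *; set y := harm_coprime _ _; set z := harm_coprime _ _.
have -> : theta * (F N k m / F N k 1) * p%:R ^+ s.+1 * (x / p%:R + (y - z)) =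
  theta * (F N k m / F N k 1) * p%:R ^+ s * x +
  F N k m / F N k 1 * p%:R ^+ s.+1 * (theta * y - theta * z).
  by rewrite exprS; field; rewrite p0 F_neq0.
rewrite rpredD ?IH // rpredM ?rpredB ?c_ok // rpredM ?F_div1_loc //.
by rewrite rpredX ?rpred_nat.
Qed.

(* Telescoping: H_(N j) is the sum over s of H_(N m p^s) - H_(N [m / p] p^(s+1))
   with m = [j / p^s], so that each difference multiplies a whole block of terms. *)
Lemma harm_term_sum p N k theta a K : prime p -> (a < p)%N -> harm_ok p N k theta ->
  theta / F N k 1 * (\sum_(j < K.+1) harm (N * j)%N * dwork_term p (F N k) a K j)
    \in zideal p 1.
Proof.
move=> p_pr lt_ap ok; have p_gt0 := prime_gt0 p_pr.
pose T := dwork_term p (F N k) a K; pose S := dwork_sum p (F N k) a K.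
pose h s m := harm (N * (m * p ^ s))%N.
(* Dwork's congruence supplies p^(s+1) F(m): the factor p^s is spent on the harmonic difference of
   level [s], and one [p] is left. *)
have term_ok s m : theta / F N k 1 * ((h s m - h s.+1 (m %/ p)%N) * S s m)
    \in zideal p 1.
  have [->|m_gt0] := posnP m.
    by rewrite /h div0n !mul0n subrr mul0r mulr0 rpred0.
  have /(zidealE _ _ p_pr)[y y_loc def_S] := F_dwork_congruence N k K s m p_pr lt_ap.
  have -> : S s m = F N k m * (p%:R ^+ s.+1 * y).
    by rewrite -def_S mulrC divfK ?F_neq0.
  apply/(zidealE _ _ p_pr); exists (theta * (F N k m / F N k 1) * p%:R ^+ s *
      (h s m - h s.+1 (m %/ p)%N) * y); last by rewrite exprS expr1; ring.
  rewrite rpredM // /h expnS [(m %/ p * _)%N]mulnA; exact: harm_level_loc.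
have step s n : theta / F N k 1 * (\sum_(j < n * p ^ s) harm (N * j)%N * T j
    - \sum_(m < n) h s m * S s m) \in zideal p 1.
  elim: s n => [|s IH] n.
    rewrite [X in _ * X](_ : _ = 0) ?mulr0 ?rpred0 //; apply/eqP; rewrite subr_eq0.
    rewrite expn0 muln1; apply/eqP/eq_bigr => j _.
    by rewrite /h /S /dwork_sum expn0 big_ord1 add0n muln1.
  have := IH (n * p)%N; rewrite -mulnA -expnS => IHn.
  have dif : theta / F N k 1 * (\sum_(m < n * p) h s m * S s m
      - \sum_(m < n) h s.+1 m * S s.+1 m) \in zideal p 1.
    rewrite (sum_blocks _ _ (fun m => h s m * S s m)) -sumrB mulr_sumr.
    apply: rpred_sum => u _; rewrite /S dwork_sumS mulr_sumr -sumrB mulr_sumr.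
    apply: rpred_sum => i _; have := term_ok s (i + u * p)%N.
    by rewrite divn_small_addM // mulrBl.
  by have := rpredD IHn dif; rewrite -mulrDr addrA subrK.
(* At level K+1 a single block covers every j <= K, and its harmonic factor is H_0 = 0. *)
have := step K.+1 1%N; rewrite mul1n big_ord1 /h mul0n muln0 [harm 0]big_nil.
rewrite mul0r subr0.
suff -> : \sum_(j < p ^ K.+1) harm (N * j)%N * T j = \sum_(j < K.+1) harm (N * j)%N * T j.
  by [].
have le_K : (K.+1 <= p ^ K.+1)%N by rewrite ltnW // ltn_expl ?prime_gt1.
rewrite -!(big_mkord xpredT (fun j => harm (N * j)%N * T j)).
rewrite (big_cat_nat (n := K.+1)) //=.
rewrite [X in _ + X](_ : _ = 0) ?addr0 // big_nat big1 // => j.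
by move=> /andP[lt_j _]; rewrite /T /dwork_term leqNgt lt_j mulr0.
Qed.

Lemma FG_congruence p N k theta n : prime p -> harm_ok p N k theta ->
  theta / F N k 1 * (fps_mul (F N k) (fps_expand p (G N k)) n
     - p%:R * fps_mul (G N k) (fps_expand p (F N k)) n) \in zideal p 1.
Proof.
move=> p_pr ok; have p_gt0 := prime_gt0 p_pr.
rewrite (divn_eq n p) addnC; set a := (n %% p)%N; set K := (n %/ p)%N.
have lt_ap : (a < p)%N by rewrite ltn_mod.
have p0 : p%:R != 0 :> rat by rewrite pnatr_eq0 -lt0n.
rewrite !fps_mul_expand // !big_mkord mulr_sumr -sumrB.
(* H_(N(K-j)) is written as H_(Nj) minus a difference; summing this difference against F(a + j p)
   F(K - j) gives the sum of the H_(Nj) T_j after the reflection j -> K - j. *)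
rewrite (_ : \sum_(i < K.+1) _ =
   - (\sum_(j < K.+1) harm (N * j)%N * dwork_term p (F N k) a K j)
   - \sum_(j < K.+1) F N k (a + j * p)%N * F N k (K - j)%N *
       (p%:R * harm (N * (a + j * p))%N - harm (N * j)%N)); last first.
  have eq_dw : \sum_(j < K.+1) harm (N * j)%N * dwork_term p (F N k) a K j =
      \sum_(j < K.+1) F N k (a + j * p)%N * F N k (K - j)%N * harm (N * j)%N -
      \sum_(j < K.+1) F N k (a + j * p)%N * F N k (K - j)%N * harm (N * (K - j))%N.
    rewrite [X in _ - X](reindex_inj rev_ord_inj) -sumrB; apply: eq_bigr => j _ /=.
    have le_jK : (j <= K)%N by rewrite -ltnS.
    by rewrite /dwork_term le_jK subSS subKn //; ring.
  rewrite eq_dw opprB -!sumrB; apply: eq_bigr => j _.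
  by rewrite /G; ring.
rewrite mulrDr !mulrN rpredB ?rpredN ?harm_term_sum // mulr_sumr.
apply: rpred_sum => j _; have [F_ok c_ok] := ok.
set i := (a + j * p)%N; have j_def : (i %/ p)%N = j by rewrite divn_small_addM.
have [i0|i_gt0] := posnP i.
  have -> : (j : nat) = 0%N by rewrite -j_def i0 div0n.
  by rewrite i0 !muln0 [harm 0]big_nil mulr0 subrr !mulr0 rpred0.
(* This makes the factor [p] explicit in p H_(N i) - H_(N j); what remains is bounded by the two
   conditions of [harm_ok]. *)
have -> : harm (N * j)%N = p%:R * (harm (N * (j * p))%N - harm_coprime p (N * (j * p))).
  rewrite [harm (N * (j * p))%N](harm_split _ p_pr) addrK mulnA mulnK //.
  by rewrite mulrC divfK.
apply/(zidealE _ _ p_pr).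
exists (F N k (K - j)%N * (theta * (F N k i / F N k 1) *
   (harm (N * i)%N - harm (N * (i %/ p * p))%N)
   + F N k i / F N k 1 * (theta * harm_coprime p (N * (j * p))))).
  rewrite rpredM ?F_loc // rpredD ?F_ok // rpredM ?c_ok //; exact: F_div1_loc.
by rewrite j_def expr1; ring.
Qed.

(** * Wolstenholme congruences and divisibility of harmonic numbers *)

Lemma harm_coprime_loc p n : prime p -> harm_coprime p n \in zloc p.
Proof.
move=> p_pr; rewrite /harm_coprime big_nat_cond rpred_sum // => i /andP[/andP[i_gt0 _] ndv].
by rewrite zlocV // prime_coprime.
Qed.

Lemma harm_coprimeS p n : harm_coprime p n.+1 =
  harm_coprime p n + (if (p %| n.+1)%N then 0 else n.+1%:R^-1).
Proof.
rewrite /harm_coprime big_mkcond big_nat_recr //= -big_mkcond.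
by case: (p %| n.+1)%N.
Qed.

Lemma harm_coprime_blocks p n : prime p ->
  harm_coprime p (n * p) = \sum_(A < n) \sum_(1 <= i < p) (A * p + i)%N%:R^-1.
Proof.
move=> p_pr; have p_gt0 := prime_gt0 p_pr.
elim: n => [|n IH]; first by rewrite big_ord0 /harm_coprime big_nil.
rewrite big_ord_recr -IH /= mulSnr /=.
have : forall r, (r < p)%N -> harm_coprime p (n * p + r) =
    harm_coprime p (n * p) + \sum_(1 <= i < r.+1) (n * p + i)%N%:R^-1.
  elim=> [|r IHr] lt_rp; first by rewrite addn0 big_nil addr0.
  rewrite addnS harm_coprimeS -addnS dvdn_addr ?dvdn_mull // gtnNdvd //.
  by rewrite IHr ?(ltnW lt_rp) // [in RHS]big_nat_recr //= addrA.
move=> /(_ p.-1); rewrite prednK // => /(_ (leqnn p)) <-.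
have def_np : (n * p + p = (n * p + p.-1).+1)%N by rewrite -addnS prednK.
by rewrite def_np harm_coprimeS -def_np dvdn_addr ?dvdn_mull // dvdnn addr0.
Qed.

Lemma sum_sym p (f : nat -> rat) :
  2 * \sum_(1 <= i < p) f i = \sum_(1 <= i < p) (f i + f (p - i)%N).
Proof.
rewrite mulr_natl mulr2n [X in _ + X = _]big_nat_rev /= -big_split /=.
by apply: eq_bigr => i _; rewrite add1n subSS.
Qed.

Lemma zideal_double p e x : prime p -> odd p -> 2 * x \in zideal p e -> x \in zideal p e.
Proof.
by move=> p_pr p_odd; apply: zideal_unitl => //; rewrite coprimen2.
Qed.

Lemma natr_lt_prime p i : prime p -> (0 < i < p)%N ->
  [/\ i%:R != 0 :> rat, (p - i)%N%:R != 0 :> rat, i%:R^-1 \in zloc p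
    & (p - i)%N%:R^-1 \in zloc p].
Proof.
move=> p_pr /andP[i_gt0 lt_ip]; have pi_gt0 : (0 < p - i)%N by rewrite subn_gt0.
rewrite !pnatr_eq0 -!lt0n !zlocV // prime_coprime // gtnNdvd //.
by rewrite ltn_subrL i_gt0 prime_gt0.
Qed.

(** In the block from A p to (A+1) p, pairing [i] with p - i gives numerators (2 A + 1) p over
    denominators prime to [p]. *)
Lemma harm_coprime_zideal1 p n : prime p -> odd p ->
  harm_coprime p (n * p) \in zideal p 1.
Proof.
move=> p_pr p_odd; rewrite harm_coprime_blocks // rpred_sum // => A _.
apply: zideal_double => //; rewrite (sum_sym p (fun i => (A * p + i)%N%:R^-1)).
rewrite big_nat rpred_sum // => i lt_i; have /andP[i_gt0 lt_ip] := lt_i.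
have nz j : (0 < j < p)%N -> (A * p + j)%N%:R != 0 :> rat /\
    (A * p + j)%N%:R^-1 \in zloc p.
  move=> /andP[j0 ltj]; rewrite pnatr_eq0 zlocV ?addn_gt0 ?j0 ?orbT //; first by split=> //; lia.
  by rewrite prime_coprime // dvdn_addr ?dvdn_mull // gtnNdvd.
have [n1 z1] := nz i lt_i.
have [|n2 z2] := nz (p - i)%N; first by rewrite subn_gt0 lt_ip ltn_subrL i_gt0 prime_gt0.
apply/(zidealE _ _ p_pr); exists ((A * 2 + 1)%N%:R * (A * p + i)%N%:R^-1 * (A * p + (p - i))%N%:R^-1).
  by rewrite !rpredM ?rpred_nat.
have def_p : p%:R = i%:R + (p - i)%N%:R :> rat by rewrite -natrD subnKC // ltnW.
move: n1 n2; rewrite !natrD !natrM def_p; set x := i%:R; set y := (p - i)%N%:R => n1 n2.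
by rewrite expr1; field; rewrite n1 n2.
Qed.

Lemma sum_even_odd h (f : nat -> rat) :
  \sum_(1 <= i < h.*2.+1) f i = \sum_(1 <= j < h.+1) (f j.*2 + f (h.*2.+1 - j.*2)%N).
Proof.
rewrite big_split /= [X in _ = _ + X]big_nat_rev /=.
rewrite [X in _ = _ + X](eq_big_nat _ _ (F2 := fun j => f j.*2.-1)); last first.
  by move=> j /andP[j_gt0 lt_jh]; congr f; lia.
elim: h => [|h IH]; first by rewrite !big_nil addr0.
rewrite doubleS [LHS]big_nat_recr //= [X in X + _ = _]big_nat_recr //= IH.
rewrite [X in _ = X + _]big_nat_recr //= [X in _ = _ + X]big_nat_recr //=.
rewrite doubleS /=; ring.
Qed.

Lemma sum_half h (f : nat -> rat) :
  \sum_(1 <= i < h.*2.+1) f i = \sum_(1 <= j < h.+1) (f j + f (h.*2.+1 - j)%N).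
Proof.
have split n k : (k <= n)%N -> \sum_(1 <= i < n.+1) f i =
    \sum_(1 <= i < (n - k).+1) f i + \sum_(1 <= j < k.+1) f (n.+1 - j)%N.
  elim: k => [|k IH] le_kn; first by rewrite subn0 [X in _ + X]big_nil addr0.
  rewrite IH ?(ltnW le_kn) // [X in _ = _ + X]big_nat_recr //= subSS.
  by rewrite -[(n - k)%N]subSS subSn // [X in X + _ = _]big_nat_recr //= -addrA [f _ + _]addrC.
have le_h : (h <= h.*2)%N by rewrite -addnn leq_addr.
have subh : (h.*2 - h = h)%N by rewrite -addnn addnK.
by rewrite big_split (split _ _ le_h) subh.
Qed.

(** Let S be the sum and s its first half. As i^(-2) is even modulo [p], S = 2 s; using instead the
    even representative of each pair {i, p - i}, S = 2 (s / 4). Hence 3 S = 4 S - S = 2 s - 2 s = 0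
    modulo [p], and 3 is invertible. *)
Lemma sum_inv_sqr_zideal p : prime p -> (3 < p)%N ->
  \sum_(1 <= i < p) i%:R^-1 ^+ 2 \in zideal p 1.
Proof.
move=> p_pr p_gt3; have p_odd : odd p by case: (even_prime p_pr) p_gt3 => [->|].
pose f i : rat := i%:R^-1 ^+ 2; pose h := p./2.
have def_p : p = h.*2.+1 by rewrite -[LHS]odd_double_half p_odd.
have f_sym i : (0 < i < p)%N -> f (p - i)%N - f i \in zideal p 1.
  move=> lt_i; have [n1 n2 z1 z2] := natr_lt_prime p_pr lt_i.
  have [i_gt0 lt_ip] := andP lt_i.
  apply/(zidealE _ _ p_pr).
  exists ((i%:R - (p - i)%N%:R) * i%:R^-1 ^+ 2 * (p - i)%N%:R^-1 ^+ 2).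
    by rewrite !rpredM ?rpredX // rpredB ?rpred_nat.
  have -> : p%:R = i%:R + (p - i)%N%:R :> rat by rewrite -natrD subnKC // ltnW.
  by rewrite /f expr1; field; rewrite n1 n2.
pose s := \sum_(1 <= j < h.+1) f j.
have even_s : \sum_(1 <= i < p) f i - 2 * \sum_(1 <= j < h.+1) f j.*2 \in zideal p 1.
  rewrite {1}def_p sum_even_odd mulr_sumr -sumrB big_nat rpred_sum // => j lt_j.
  rewrite -def_p (_ : _ - _ = f (p - j.*2)%N - f j.*2); last by ring.
  apply: f_sym; move: def_p lt_j; lia.
have half_s : \sum_(1 <= i < p) f i - 2 * s \in zideal p 1.
  rewrite {1}def_p sum_half mulr_sumr -sumrB big_nat rpred_sum // => j lt_j.
  rewrite -def_p (_ : _ - _ = f (p - j)%N - f j); last by ring.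
  apply: f_sym; move: def_p lt_j; lia.
have def_even : \sum_(1 <= j < h.+1) f j.*2 = s / 4.
  rewrite mulr_suml; apply: eq_bigr => j _.
  by rewrite /f -mul2n natrM invfM exprMn mulrC.
apply: (@zideal_unitl p 1 3) => //.
  by rewrite prime_coprime // gtnNdvd.
rewrite def_even in even_s.
set S := \sum_(1 <= i < p) f i in even_s half_s.
have -> : 3%:R * \sum_(1 <= i < p) i%:R^-1 ^+ 2 = 4 * (S - 2 * (s / 4)) - (S - 2 * s).
  by rewrite -/S; field.
by rewrite rpredB // zidealMl // rpred_nat.
Qed.

Lemma sum_inv_cube_zideal p : prime p -> odd p ->
  \sum_(1 <= i < p) i%:R^-1 ^+ 3 \in zideal p 1.
Proof.
move=> p_pr p_odd; apply: zideal_double => //.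
rewrite (sum_sym p (fun i => i%:R^-1 ^+ 3)) big_nat rpred_sum // => i lt_i.
have [n1 n2 z1 z2] := natr_lt_prime p_pr lt_i; have [i_gt0 lt_ip] := andP lt_i.
apply/(zidealE _ _ p_pr); pose x : rat := i%:R; pose y : rat := (p - i)%N%:R.
exists ((x ^+ 2 - x * y + y ^+ 2) * x^-1 ^+ 3 * y^-1 ^+ 3).
  by rewrite !rpredM ?rpredX // rpredD ?rpredB ?rpredM ?rpredX ?rpred_nat.
have -> : p%:R = x + y by rewrite -natrD subnKC // ltnW.
by rewrite expr1 -/x -/y; field; rewrite n1 n2.
Qed.

(* From 1/i + 1/(p - i) = p / (i (p - i)) and the expansion of 1/(p - i) in powers of p. *)
Lemma harm_pred_zideal3 p : prime p -> (3 < p)%N ->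
  2 * harm p.-1 + p%:R * \sum_(1 <= i < p) i%:R^-1 ^+ 2 \in zideal p 3.
Proof.
move=> p_pr p_gt3; have p_odd : odd p by case: (even_prime p_pr) p_gt3 => [->|].
have p_gt0 := prime_gt0 p_pr.
have -> : 2 * harm p.-1 + p%:R * \sum_(1 <= i < p) i%:R^-1 ^+ 2 =
    p%:R ^+ 3 * (\sum_(1 <= i < p) i%:R^-1 ^+ 3 * (p - i)%N%:R^-1)
    - p%:R ^+ 2 * \sum_(1 <= i < p) i%:R^-1 ^+ 3.
  rewrite /harm prednK // (sum_sym p (fun i => i%:R^-1)) !mulr_sumr -sumrB -big_split.
  apply: eq_big_nat => i lt_i; have [n1 n2 _ _] := natr_lt_prime p_pr lt_i.
  have [i_gt0 lt_ip] := andP lt_i; move: n1 n2.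
  have -> : p%:R = i%:R + (p - i)%N%:R :> rat by rewrite -natrD subnKC // ltnW.
  by set x := i%:R; set y := (p - i)%N%:R => n1 n2 /=; field; rewrite n1 n2.
rewrite rpredB //.
  apply: zidealMr; first exact: zideal_expn.
  rewrite big_nat rpred_sum // => i lt_i; have [_ _ z1 z2] := natr_lt_prime p_pr lt_i.
  by rewrite rpredM ?rpredX.
by apply: (@zidealM p 2 1); [apply: zideal_expn | apply: sum_inv_cube_zideal].
Qed.

(** Wolstenholme's theorem. *)
Lemma harm_pred_zideal2 p : prime p -> (3 < p)%N -> harm p.-1 \in zideal p 2.
Proof.
move=> p_pr p_gt3; have p_odd : odd p by case: (even_prime p_pr) p_gt3 => [->|].
apply: zideal_double => //.
have := zidealW p_pr (leqnSn 2) (harm_pred_zideal3 p_pr p_gt3).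
rewrite rpredDr //; apply: (@zidealM p 1 1); first exact: zideal_p.
exact: sum_inv_sqr_zideal.
Qed.

(** Expanding 1/(A p + i) to third order in [p], the block of index [A] contributes (2 A + 1)
    H_(p-1) modulo p^3, the linear term being turned into 2 A H_(p-1) by [harm_pred_zideal3]. The
    odd numbers 2 A + 1 add up to n^2. *)
Lemma harm_coprime_zideal3 p n : prime p -> (3 < p)%N ->
  harm_coprime p (n * p) - (n ^ 2)%:R * harm p.-1 \in zideal p 3.
Proof.
move=> p_pr p_gt3; have p_odd : odd p by case: (even_prime p_pr) p_gt3 => [->|].
have p_gt0 := prime_gt0 p_pr.
have -> : (n ^ 2)%:R * harm p.-1 = \sum_(A < n) (A.*2.+1)%:R * harm p.-1.
  rewrite -mulr_suml -natr_sum; congr (_%:R * _).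
  by elim: n => [|n IH]; rewrite ?big_ord0 // big_ord_recr /= -IH; lia.
rewrite harm_coprime_blocks // -sumrB rpred_sum // => A _.
have -> : \sum_(1 <= i < p) (A * p + i)%N%:R^-1 - (A.*2.+1)%:R * harm p.-1 =
   (A ^ 2)%:R * (p%:R ^+ 2 * \sum_(1 <= i < p) i%:R^-1 ^+ 3)
   - (A ^ 3)%:R * (p%:R ^+ 3 * \sum_(1 <= i < p) i%:R^-1 ^+ 3 * (A * p + i)%N%:R^-1)
   - A%:R * (2 * harm p.-1 + p%:R * \sum_(1 <= i < p) i%:R^-1 ^+ 2).
  suff -> : \sum_(1 <= i < p) (A * p + i)%N%:R^-1 = harm p.-1
     - A%:R * (p%:R * \sum_(1 <= i < p) i%:R^-1 ^+ 2)
     + (A ^ 2)%:R * (p%:R ^+ 2 * \sum_(1 <= i < p) i%:R^-1 ^+ 3)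
     - (A ^ 3)%:R * (p%:R ^+ 3 * \sum_(1 <= i < p) i%:R^-1 ^+ 3 * (A * p + i)%N%:R^-1).
    have -> : (A.*2.+1)%:R = A%:R * 2 + 1 :> rat by rewrite -muln2 -natr1 natrM.
    by ring.
  rewrite /harm prednK // !mulr_sumr -sumrB -big_split -sumrB.
  apply: eq_big_nat => i lt_i; have [n1 _ _ _] := natr_lt_prime p_pr lt_i.
  have [i_gt0 lt_ip] := andP lt_i.
  have : (A * p + i)%N%:R != 0 :> rat by rewrite pnatr_eq0; lia.
  move: n1; rewrite /= !natrX natrD natrM; set x := i%:R; set a := A%:R.
  by move=> n1 n2; field; rewrite n1 n2.
apply: rpredB; first apply: rpredB; apply: zidealMl; rewrite ?rpred_nat //.
- by apply: (@zidealM p 2 1); [apply: zideal_expn | apply: sum_inv_cube_zideal].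
- apply: zidealMr; first exact: zideal_expn.
  rewrite big_nat rpred_sum // => i lt_i; have [_ _ z1 _] := natr_lt_prime p_pr lt_i.
  have [i_gt0 lt_ip] := andP lt_i.
  rewrite rpredM ?rpredX // zlocV ?addn_gt0 ?i_gt0 ?orbT //.
  by rewrite prime_coprime // dvdn_addr ?dvdn_mull // gtnNdvd.
exact: harm_pred_zideal3.
Qed.

(** * Which harmonic numbers a prime can divide *)

(** The descent step: p-integrality of H_N forces [p] to divide H_[N/p]. *)
Lemma harm_div_zideal p N : prime p -> harm N \in zloc p ->
  harm (N %/ p) \in zideal p 1.
Proof.
move=> p_pr; by rewrite (harm_split N p_pr) rpredDr ?harm_coprime_loc.
Qed.

Lemma zideal_fracP p e x y (n : nat) : prime p -> x \in zideal p e ->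
  y \in zloc p -> x * y = n%:R -> (p ^ e %| n)%N.
Proof.
by move=> p_pr x_e y_loc def_n; apply: zideal_natP; rewrite // -def_n zidealMr.
Qed.

Lemma one_notin_zideal p : prime p -> 1 \notin zideal p 1.
Proof.
by move=> p_pr; apply/negP => /(@zideal_natP p 1 1 p_pr); rewrite Euclid_dvd1.
Qed.

Lemma harm0 : harm 0 = 0.
Proof. by rewrite /harm big_nil. Qed.

Lemma harmS n : harm n.+1 = harm n + n.+1%:R^-1.
Proof. by rewrite /harm big_nat_recr. Qed.

Lemma harm2_notin p : prime p -> (3 < p)%N -> harm 2 \notin zideal p 1.
Proof.
move=> p_pr p_gt3; apply/negP => H2.
have : (p ^ 1 %| 3)%N.
  by apply: (zideal_fracP p_pr H2 (rpred_nat _ 2)); rewrite !harmS harm0; field.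
by rewrite expn1 gtnNdvd.
Qed.

Lemma harm3_zideal p : prime p -> harm 3 \in zideal p 1 -> p = 11%N.
Proof.
move=> p_pr H3; apply/eqP; rewrite -dvdn_prime2 //.
apply: (zideal_fracP (e := 1) p_pr H3 (rpred_nat _ 6)).
by rewrite !harmS harm0; field.
Qed.

Lemma harm3_notin_11 : harm 3 \notin zideal 11 2.
Proof.
apply/negP => H3.
suff : (11 ^ 2 %| 11)%N by [].
apply: (zideal_fracP _ H3 (rpred_nat _ 6)) => //.
by rewrite !harmS harm0; field.
Qed.

(** That is, 11 is not a Wolstenholme prime; 11 needs separate treatment because it divides H_3 =
    11/6. *)
Lemma harm10_notin_11 : harm 10 \notin zideal 11 3.
Proof.
apply/negP; have -> : harm 10 = 11 ^+ 2 * (61 / (7 * 360)) by rewrite !harmS harm0; field.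
move=> /(@zideal_cancel 11 1 2 _ isT) H.
suff : (11 ^ 1 %| 61)%N by [].
have y_loc : 7 * 360 \in zloc 11 by apply: rpredM; apply: rpred_nat.
by apply: (zideal_fracP (isT : prime 11) H y_loc); field.
Qed.

Lemma harm7_mod3 : harm 7 \in zideal 3 1.
Proof.
apply/(zidealE _ _ (isT : prime 3)); exists (11 ^+ 2 * 140%:R^-1).
  by apply: rpredM; [apply: rpredX; apply: rpred_nat | apply: zlocV].
by rewrite !harmS harm0; field.
Qed.

(** The residue of H_22 / 3 determines that of H_66, which ends the descent for p = 3. *)
Lemma harm22_mod3 : harm 22 / 3 - 1 \in zideal 3 1.
Proof.
apply/(zidealE _ _ (isT : prime 3)).
exists (3 * 107 * 1237 * 16%:R^-1 * 77%:R^-1 * 13%:R^-1 * 17%:R^-1 * 19%:R^-1).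
  by do 5![apply: rpredM; last by apply: zlocV];
     apply: rpredM; first apply: rpredM; apply: rpred_nat.
by rewrite !harmS harm0; field.
Qed.

Lemma harm22_zideal1 : harm 22 \in zideal 3 1.
Proof.
have p3 : prime 3 by [].
have := rpredD (zideal_loc p3 harm22_mod3) (rpred1 (zloc 3)).
by rewrite subrK in_zideal.
Qed.

Lemma harm22_notin : harm 22 \notin zideal 3 2.
Proof.
have p3 : prime 3 by [].
apply/negP => H; have : harm 22 / 3 \in zideal 3 1.
  apply: (@zideal_cancel 3 1 1) => //.
  by rewrite expr1 mulrC divfK.
by rewrite -(subrK 1 (harm 22 / 3)) rpredDl ?harm22_mod3.
Qed.

(** The descent N -> [N/2] ends at H_1 = 1. *)
Lemma harm_notin_2 N : (0 < N)%N -> harm N \notin zideal 2 1.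
Proof.
have p2 : prime 2 by [].
elim/ltn_ind: N => N IH N_gt0; apply/negP => N_in.
have := harm_div_zideal p2 (zideal_loc p2 N_in).
case: (ltnP N 2) => [N_lt2|N_ge2].
  have N1 : N = 1%N by apply/eqP; rewrite eqn_leq N_gt0 -ltnS N_lt2.
  by move: N_in; rewrite N1 harmS harm0 add0r invr1 (negPf (one_notin_zideal p2)).
by apply/negP/IH; rewrite ?divn_gt0 ?ltn_Pdiv.
Qed.

Lemma natrV_notin p n : prime p -> (0 < n)%N -> n%:R^-1 \notin zideal p 1.
Proof.
move=> p_pr n_gt0; apply/negP => H.
have := zidealMl (rpred_nat (zloc p) n) H; rewrite divff ?pnatr_eq0 -?lt0n //.
by apply/negP; apply: one_notin_zideal.
Qed.

(** By descent [N/3] is 2, 7 or 22, which leaves 6 to 8, 21 to 23 and 66 to 68. Next to 7 and 22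
    nothing else survives, as consecutive harmonic numbers differ by some 1/n outside 3 Z_(3); H_66,
    H_67 and H_68 are 1, 2 and 4 modulo 3. *)
Lemma harm_zideal_3 N : (0 < N)%N -> harm N \in zideal 3 1 ->
  [\/ N = 2%N, N = 7%N | N = 22%N].
Proof.
have p3 : prime 3 by [].
elim/ltn_ind: N => N IH N_gt0 N_in.
case: (ltnP N 3) => [N_lt3|N_ge3].
  case: N N_gt0 N_lt3 N_in {IH} => [|[|[|]]] // _ _; last by constructor.
  by rewrite harmS harm0 add0r invr1 (negPf (one_notin_zideal p3)).
have hN := divn_eq N 3; have lt3 := ltn_pmod N (isT : (0 < 3)%N).
have HM := harm_div_zideal p3 (zideal_loc p3 N_in).
have M_gt0 : (0 < N %/ 3)%N by rewrite divn_gt0.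
have next n : harm n \in zideal 3 1 -> harm n.+1 \notin zideal 3 1.
  move=> Hn; apply/negP; rewrite harmS rpredDl // => H.
  by have := natrV_notin p3 (ltn0Sn n); rewrite H.
have prev n : harm n.+1 \in zideal 3 1 -> harm n \notin zideal 3 1.
  by move=> Hn; apply/negP => /next; rewrite Hn.
have fromM M n : harm n - M%:R \in zideal 3 1 -> ~~ (3 %| M)%N -> N <> n.
  move=> Hn ndv N_n; move: N_in; rewrite N_n -(subrK M%:R (harm n)) rpredDl //.
  by move/(zideal_natP p3); rewrite expn1 (negPf ndv).
have H66 : harm 66 - 1%:R \in zideal 3 1.
  rewrite (harm_split 66 p3) addrAC rpredD ?harm22_mod3 //.
  exact: (@harm_coprime_zideal1 3 22).
have H67 : harm 67 - 2%:R \in zideal 3 1.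
  rewrite harmS (_ : _ - _ = harm 66 - 1%:R - 3%:R ^+ 1 * (22 * 67%:R^-1)); last by field.
  apply: rpredB; [exact: H66 | apply: zidealMr; first exact: zideal_expn].
  by apply: rpredM; [apply: rpred_nat | apply: zlocV].
have H68 : harm 68 - 4%:R \in zideal 3 1.
  rewrite harmS (_ : _ - _ = harm 67 - 2%:R - 3%:R ^+ 1 * (45 * 68%:R^-1)); last by field.
  apply: rpredB; [exact: H67 | apply: zidealMr; first exact: zideal_expn].
  by apply: rpredM; [apply: rpred_nat | apply: zlocV].
have not66 := fromM _ _ H66 isT; have not67 := fromM _ _ H67 isT.
have not68 := fromM _ _ H68 isT.
have notS n : harm n \in zideal 3 1 -> N <> n.+1.
  by move=> /next /negP Hn N_n; apply: Hn; rewrite -N_n.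
have notP n : harm n.+1 \in zideal 3 1 -> N <> n.
  by move=> /prev /negP Hn N_n; apply: Hn; rewrite -N_n.
have not8 := notS _ harm7_mod3; have not6 := notP _ harm7_mod3.
have not23 := notS _ harm22_zideal1; have not21 := notP _ harm22_zideal1.
case: (IH (N %/ 3)%N _ M_gt0 HM) => [|M2|M7|M22]; first by rewrite ltn_Pdiv.
- by apply: Or32; move: hN; rewrite M2; lia.
- by apply: Or33; move: hN; rewrite M7; lia.
by exfalso; move: hN; rewrite M22; lia.
Qed.

(** * Valuations and the local conditions for Xi_N *)

Lemma ratval_zloc p x : prime p ->
  exists2 y, y \in zloc p & x = p%:R ^ (ratval p x) * y.
Proof.
move=> p_pr; have p0 : p%:R != 0 :> rat by rewrite pnatr_eq0 -lt0n prime_gt0.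
have [num0|num_gt0] := posnP `|numq x|%N.
  by exists 0; rewrite ?rpred0 // mulr0; apply/eqP; rewrite -numq_eq0 -absz_eq0 num0.
have den_gt0 : (0 < `|denq x|)%N by rewrite absz_gt0 denq_neq0.
have [n _ def_n] := pfactor_coprime p_pr num_gt0.
have [d co_d def_d] := pfactor_coprime p_pr den_gt0.
have d_gt0 : (0 < d)%N by move: den_gt0; rewrite def_d muln_gt0 => /andP[].
exists ((sgz (numq x))%:~R * n%:R / d%:R).
  by rewrite !rpredM ?rpred_nat ?rpred_int // zlocV.
set a := logn p `|numq x| in def_n *; set b := logn p `|denq x| in def_d *.
have num_x : (numq x)%:~R = (sgz (numq x))%:~R * (n%:R * p%:R ^+ a) :> rat.
  rewrite {1}[numq x]intEsg rmorphM /=; congr (_ * _).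
  by rewrite -pmulrn def_n natrM natrX.
have den_x : (denq x)%:~R = d%:R * p%:R ^+ b :> rat.
  by rewrite -absz_denq -pmulrn def_d natrM natrX.
rewrite /ratval -/a -/b expfzDr // -invr_expz -!exprnP.
rewrite -{1}[x]divq_num_den num_x den_x.
by field; rewrite pnatr_eq0 -lt0n d_gt0 expf_neq0.
Qed.

Lemma zloc_pexpz p (z : int) : 0 <= z -> p%:R ^ z \in zloc p.
Proof. by case: z => // n _; rewrite -exprnP rpredX ?rpred_nat. Qed.

Lemma ratval_zideal p e x : prime p -> e%:Z <= ratval p x -> x \in zideal p e.
Proof.
move=> p_pr le_e; have p0 : p%:R != 0 :> rat by rewrite pnatr_eq0 -lt0n prime_gt0.
have [y y_loc ->] := ratval_zloc x p_pr.
apply/(zidealE _ _ p_pr); exists (p%:R ^ (ratval p x - e%:Z) * y).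
  by rewrite rpredM // zloc_pexpz // subr_ge0.
by rewrite mulrA exprnP -expfzDr // addrC subrK.
Qed.

Lemma harm_ok_intro p N k t theta : prime p -> (0 < k)%N ->
  theta * harm N \in zloc p -> theta * p%:R ^+ t \in zloc p ->
  (t == 0%N) || (t.+1 * p <= N)%N ->
  (forall j, harm_coprime p (N * (j * p)) \in zideal p t) -> harm_ok p N k theta.
Proof.
move=> p_pr k_gt0 th_harm th_t cond Ht; split=> [m m_gt0|j].
  exact: F_harm_loc th_t cond m_gt0.
by have /(zidealE _ _ p_pr)[y y_loc ->] := Ht j; rewrite mulrA rpredM.
Qed.

(** The sum is (N j)^2 H_(p-1) modulo p^3, and p^2 divides H_(p-1). A third power of [p] comes from
    [N] or from a Wolstenholme prime, the two cases where [xi] is 1. *)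
Lemma harm_coprime_mult_zideal p N t : prime p -> (3 < p)%N -> (t <= 3)%N ->
  (t = 3%N -> (p %| N)%N \/ harm p.-1 \in zideal p 3) ->
  forall j, harm_coprime p (N * (j * p)) \in zideal p t.
Proof.
move=> p_pr p_gt3 le_t t3 j; rewrite mulnA.
have H3 := harm_coprime_zideal3 (N * j) p_pr p_gt3.
have H2 := harm_pred_zideal2 p_pr p_gt3.
rewrite -[harm_coprime _ _](subrK (((N * j) ^ 2)%:R * harm p.-1)).
apply: rpredD; first exact: zidealW H3.
case: (ltngtP t 3) le_t => // [lt_t3 _|def_t _].
  by apply: zidealMl; [apply: rpred_nat | apply: zidealW H2].
rewrite def_t; case: (t3 def_t) => [dv_N|W]; last first.
  by apply: zidealMl => //; apply: rpred_nat.
apply: (zidealW p_pr (_ : 3 <= 2 + 2)%N) => //; apply: zidealM => //.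
by apply: zideal_nat => //; rewrite dvdn_exp2r // dvdn_mulr.
Qed.

(** Let M = [N/p], so that [p] divides H_M. This excludes M = 1 and M = 2; M >= 4 suffices for t <=
    3; M = 3 forces p = 11, where t = 3 is ruled out. *)
Lemma harm_zideal_large p N t : prime p -> (3 < p)%N -> (p <= N)%N -> (0 < t <= 3)%N ->
  harm N \in zideal p t -> (t = 3%N -> (p %| N)%N \/ harm p.-1 \in zideal p 3) ->
  (t.+1 * p <= N)%N.
Proof.
move=> p_pr p_gt3 le_pN /andP[t_gt0 le_t] HN t3; have p_gt0 := prime_gt0 p_pr.
have HM := harm_div_zideal p_pr (zideal_loc p_pr HN).
have le_MpN := leq_trunc_div N p.
have large M : (M <= N %/ p)%N -> (t < M)%N -> (t.+1 * p <= N)%N.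
  move=> le_M lt_tM; apply: leq_trans le_MpN.
  by rewrite leq_mul2r (leq_trans lt_tM) ?orbT.
case: (ltnP 3 (N %/ p)) => [M_gt3|]; first by apply: large M_gt3 _.
case def_M: (N %/ p)%N HM => [|[|[|[|//]]]] HM _.
- by move: def_M; rewrite -(divn_small (m := 0) p_gt0); lia.
- by move: HM; rewrite harmS harm0 add0r invr1 (negPf (one_notin_zideal p_pr)).
- by move: HM; rewrite (negPf (harm2_notin p_pr p_gt3)).
have p11 := harm3_zideal p_pr HM.
case: (ltngtP t 3) le_t => // [lt_t3 _|def_t _].
  by apply: (large 3%N) => //; rewrite def_M.
exfalso; subst p t; case: (t3 erefl) => [dv_N|]; last first.
  by apply/negP; apply: harm10_notin_11.
(* Here H_33 = H_3 / 11 plus a multiple of 11^2, so 11^3 dividing H_33 would make 11^2 divide H_3 =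
   11/6. *)
have def_N : N = (3 * (1 * 11))%N by rewrite -(divnK dv_N) def_M.
have c2 : harm_coprime 11 N \in zideal 11 2.
  by rewrite def_N; apply: harm_coprime_mult_zideal.
have : harm 3 / 11%:R \in zideal 11 2.
  have := zidealW p_pr (leqnSn 2) HN.
  by rewrite (harm_split N p_pr) def_M rpredDr.
move=> /(zidealM (zideal_p p_pr)); rewrite mulrC divfK //.
by move=> /(zidealW p_pr (leqnSn 2)); apply/negP; apply: harm3_notin_11.
Qed.

Definition Xi_exp p N : int := Num.min (2 + (xi p N)%:Z) (ratval p (harm N)).

(** The factors of Xi_N at primes other than [p] are p-adic units; [u] collects their inverses. *)
Lemma Xi_inv_zloc p N : prime p -> N != 1%N -> N != 7%N ->
  exists2 u, u \in zloc p &
    1 / Xi N = (if (p <= N)%N then p%:R ^ (- Xi_exp p N) else 1) * u.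
Proof.
move=> p_pr /negPf N1 /negPf N7; rewrite /Xi N1 N7 div1r -prodfV.
have q_loc (q : 'I_N.+1) : prime q -> q != p :> nat ->
    (q%:R ^ Xi_exp q N)^-1 \in zloc p.
  move=> q_pr neq_qp; rewrite invr_expz.
  case: (- _) => m; first by rewrite -exprnP rpredX ?rpred_nat.
  rewrite NegzE -invr_expz -exprnP -exprVn rpredX // zlocV ?prime_gt0 //.
  by rewrite prime_coprime // dvdn_prime2 // eq_sym.
case: leqP => [le_pN|lt_Np].
  have lt_p : (p < N.+1)%N by [].
  rewrite (bigD1 (Ordinal lt_p)) //= invr_expz.
  exists (\prod_(q < N.+1 | prime q && (q != Ordinal lt_p)) (q%:R ^ Xi_exp q N)^-1) => //.
  by apply: rpred_prod => q /andP[q_pr neq_qp]; apply: q_loc.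
exists (\prod_(q < N.+1 | prime q) (q%:R ^ Xi_exp q N)^-1); last by rewrite mul1r.
apply: rpred_prod => q q_pr; apply: q_loc => //.
by rewrite neq_ltn (leq_ltn_trans _ lt_Np) // -ltnS.
Qed.

Lemma harm_ok_Xi p N k : prime p -> (0 < N)%N -> (0 < k)%N -> harm_ok p N k (1 / Xi N).
Proof.
move=> p_pr N_gt0 k_gt0.
have t0 theta : theta * harm N \in zloc p -> theta \in zloc p -> harm_ok p N k theta.
  move=> th_h th; apply: (@harm_ok_intro p N k 0) => //; first by rewrite expr0 mulr1.
  by move=> j; rewrite zideal0 harm_coprime_loc.
case: (eqVneq N 1%N) => [N1|N1].
  by apply: t0; rewrite /Xi N1 eqxx divr1 ?harmS ?harm0 ?add0r ?invr1 ?mulr1 rpred1.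
case: (eqVneq N 7%N) => [N7|N7].
  have -> : 1 / Xi N = 140%:R by rewrite /Xi N7 /=; field.
  apply: t0; last exact: rpred_nat.
  have -> : 140%:R * harm N = 363%:R by rewrite N7 !harmS harm0; field.
  exact: rpred_nat.
have [u u_loc ->] := Xi_inv_zloc p_pr N1 N7.
case: leqP => [le_pN|lt_Np]; last first.
  apply: t0; rewrite mul1r // rpredM // /harm big_nat rpred_sum // => i /andP[i_gt0 le_iN].
  by rewrite zlocV // prime_coprime // gtnNdvd // (leq_ltn_trans _ lt_Np).
have p0 : p%:R != 0 :> rat by rewrite pnatr_eq0 -lt0n prime_gt0.
set e := Xi_exp p N.
have le_e : e <= ratval p (harm N) by rewrite /e /Xi_exp ge_min lexx orbT.
have th_h : p%:R ^ (- e) * u * harm N \in zloc p.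
  have [y y_loc ->] := ratval_zloc (harm N) p_pr.
  rewrite mulrACA -expfzDr // rpredM ?rpredM // zloc_pexpz //.
  by rewrite addrC subr_ge0.
(* A nonpositive exponent makes [theta] p-integral, and t = 0 serves. Otherwise [t] is the exponent
   of [p] in Xi_N and p^t divides H_N. *)
have [e_le0|e_gt0] := lerP e 0.
  by apply: t0; rewrite // rpredM // zloc_pexpz // oppr_ge0.
case def_e: e e_gt0 => [t|//] t_gt0.
have HN : harm N \in zideal p t by apply: ratval_zideal; rewrite // -def_e.
have le_xi : t%:Z <= 2 + (xi p N)%:Z by rewrite -def_e /e /Xi_exp ge_min lexx.
have {}t_gt0 : (0 < t)%N by [].
have HN1 := zidealW p_pr t_gt0 HN.
have p_neq2 : p != 2%N.
  by apply/eqP => p2; move: HN1; rewrite p2 (negPf (harm_notin_2 N_gt0)).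
have p_odd : odd p by case: (even_prime p_pr) p_neq2 => [->|].
suff [le_N Ht] : (t.+1 * p <= N)%N /\
    forall j, harm_coprime p (N * (j * p)) \in zideal p t.
  rewrite def_e in th_h *; apply: (harm_ok_intro p_pr k_gt0 th_h _ _ Ht).
    by rewrite mulrAC -invr_expz -exprnP mulVf ?mul1r // expf_neq0.
  by rewrite le_N orbT.
have [p3|p_neq3] := eqVneq p 3%N.
  subst p; have N22 : N = 22%N.
    case: (harm_zideal_3 N_gt0 HN1) => // Neq; first by rewrite Neq in le_pN.
    by rewrite Neq in N7.
  have t1 : t = 1%N.
    apply/eqP; rewrite eqn_leq t_gt0 andbT leqNgt; apply/negP => t_gt1.
    by have := zidealW p_pr t_gt1 HN; rewrite N22 (negPf harm22_notin).
  by rewrite N22 t1; split=> // j; rewrite mulnA; apply: harm_coprime_zideal1.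
have p_gt3 : (3 < p)%N.
  by move: p_pr p_neq2 p_neq3; case: (p) => [|[|[|[|]]]].
have le_t3 : (t <= 3)%N by move: le_xi; rewrite /xi; case: (_ || _) => /=; lia.
have t3 : t = 3%N -> (p %| N)%N \/ harm p.-1 \in zideal p 3.
  move=> t3; move: le_xi; rewrite t3 /xi; case: (boolP (_ || _)) => // + _.
  case/orP => [/andP[_ W]|]; last by left.
  by right; apply: ratval_zideal.
split; last exact: harm_coprime_mult_zideal.
by apply: harm_zideal_large => //; rewrite t_gt0.
Qed.

(** * Integrality of the root of q *)

Lemma fps_div_mul (G F : fps) : F 0%N != 0 -> fps_mul F (fps_div G F) =1 G.
Proof.
move=> F_neq0 n; rewrite fps_mulC -fps_mulA -[RHS]fps_mul_oner.
by apply: eq_fps_mul => // m _; rewrite fps_mulC fps_mul_inv.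
Qed.

Theorem theorem1 (N k : nat) (hN : (1 <= N)%N) (hk : (1 <= k)%N) :
  exists r : nat -> int,
    is_fps_rpow (q N k) (1 / (Xi N * (N`! ^ k)%N%:R)) (fun n => (r n)%:~R).
Proof.
pose g := fps_div (G N k) (F N k); set alpha := 1 / _.
have F_neq := F_neq0 N k 0.
have g0 : g 0%N = 0.
  have := fps_div_mul (G N k) F_neq 0; rewrite {1}/fps_mul big_ord1 F0 mul1r subn0 -/g => ->.
  by rewrite /G muln0 harm0 mul0r.
have exp_int n : fps_exp (fps_scale alpha g) n \is a Num.int.
  apply: fps_exp_int => [|p i p_pr i_gt0]; first by rewrite /fps_scale g0 mulr0.
  have p0 : p%:R != 0 :> rat by rewrite pnatr_eq0 -lt0n prime_gt0.
  have alphaE : alpha = 1 / Xi N / F N k 1.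
    by rewrite F_fact_ratio fact_ratio1 -natrX /alpha !div1r invfM.
  have C_loc m := FG_congruence m p_pr (harm_ok_Xi p_pr hN hk).
  have := dwork_quotient p_pr (F0 N k) (F_loc p N k) (fps_div_mul _ F_neq) C_loc i.
  (* Changing the sign and dividing by [p] turns the congruence for g(z^p) - p g(z) into the
     hypothesis of [fps_exp_int]. *)
  rewrite -alphaE -rpredN in_zideal expr1 -/g /fps_expand /fps_scale.
  set x := (X in X \in _ -> _); set y := (X in _ -> X \in _); suff -> : y = x by [].
  by rewrite /x /y; case: ifP => _; field.
exists (fun n => numq (fps_exp (fps_scale alpha g) n)), g.
by split=> // n; rewrite numqK.
Qed.
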